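(* For every $L\ge 0$ and $A>0$ there exists a positive number $C(A,L)$, depending only on $A$ and $L$, such that the following holds. Let $n\ge 2$ and let $P(z)=\sum_{k=0}^n\lambda_k z^k$ be a random polynomial whose vector of coefficients $\lambda=(\lambda_0,\dots,\lambda_n)$ is a $\mathbb C^{n+1}$-valued random variable having the property $(\Theta)$ and satisfying $\mathbb P\{\lambda_0=0\}=\mathbb P\{\lambda_n=0\}=0$. Then, with probability at least $1-n^{-A}$, \[ \sup\bigl\{N(\Gamma;P)\colon \Gamma \text{ is an } L\text{-Lipschitz curve}\bigr\}\le C(A,L)\,V(P)\,\log^3 n . \]
   Context: Flip-invariance: let $\lambda'=(\lambda'_0,\dots,\lambda'_n)$ and $\lambda''=(\lambda''_0,\dots,\lambda''_n)$ be $\mathbb C^{n+1}$-valued random variables defined on the same probability space and having the same distribution. Put $\lambda_k^+=\lambda_k'$, $\lambda_k^-=\lambda_k''$ for $0\le k\le n$, and for a tuple of signs $\sigma=(\sigma_0,\dots,\sigma_n)\in\{+,-\}^{n+1}$ let $\lambda^\sigma=(\lambda_0^{\sigma_0},\lambda_1^{\sigma_1},\dots,\lambda_n^{\sigma_n})$. The joint law of $\lambda'$ and $\lambda''$ is called flip-invariant if all the random variables $\lambda^\sigma$, $\sigma\in\{+,-\}^{n+1}$, are equidistributed. Property $(\Theta)$: the coefficients $\lambda\in\mathbb C^{n+1}$ (not assumed independent or identically distributed) have the property $(\Theta)$ if there exist random variables $\lambda'$ and $\lambda''$, each equidistributed with $\lambda$, whose joint law is flip-invariant and such that, for some (non-random)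 $a\in\mathbb C$ and for each $k\in\{0,1,\dots,n\}$, almost surely \[ |\lambda_k^{+}-\lambda_k^{-}|\ge\tfrac12\bigl[\,|\lambda_k^{+}-a|+|\lambda_k^{-}-a|\,\bigr]. \] The number $V(P)$ is the number of vertices on the graph of the convex polygonal (piecewise linear) function $t\mapsto\max_{0\le k\le n}\bigl(\log|\lambda_k|+kt\bigr)$, $t\in\mathbb R$ (with $\log 0=-\infty$), i.e. the number of points at which its slope changes. Lipschitz curves: $\Gamma$ denotes a curve in $\mathbb C$ given in polar coordinates by $\Gamma=\{z=re^{\mathrm i\theta}\colon\theta=\theta(r),\ 0\le r<\infty\}$, where $\theta$ is a real-valued function. It is called $L$-Lipschitz if $|\theta(r_1)-\theta(r_2)|\le L\,\bigl|\log\frac{r_1}{r_2}\bigr|$ for all $r_1,r_2>0$. $N(\Gamma;P)$ is the number of zeroes of $P$ on $\Gamma$, counted with multiplicities. *)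

(* Defs.v *)
From HB Require Import structures.
From mathcomp Require Import all_boot all_order all_algebra.
From mathcomp Require Import all_classical all_reals all_analysis.
From mathcomp Require Import complex.

Set Implicit Arguments.
Unset Strict Implicit.
Unset Printing Implicit Defensive.

Import Order.TTheory GRing.Theory Num.Theory.
Import numFieldNormedType.Exports.

Local Open Scope classical_set_scope.
Local Open Scope ring_scope.

(* The Borel sigma-algebra of the complex plane, obtained by identifying it
   with the real plane: it is generated by the real and imaginary parts. The
   sigma-algebra of C^m is then the library's product sigma-algebra on tuples. *)
Section complex_measurable.
Context {R : realType}.

HB.instance Definition _ := isPointed.Build R[i] 0.

Let C_set0 : g_sigma_preimageU (@complex.Re R) (@complex.Im R) set0.
Proof. exact: sigma_algebra0. Qed.

Let C_setC (B : set R[i]) : g_sigma_preimageU (@complex.Re R) (@complex.Im R) B ->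
  g_sigma_preimageU (@complex.Re R) (@complex.Im R) (~` B).
Proof. exact: sigma_algebraC. Qed.

Let C_bigcup (F : (set R[i])^nat) :
  (forall i, g_sigma_preimageU (@complex.Re R) (@complex.Im R) (F i)) ->
  g_sigma_preimageU (@complex.Re R) (@complex.Im R) (\bigcup_i F i).
Proof. exact: sigma_algebra_bigcup. Qed.

HB.instance Definition _ := @isMeasurable.Build default_measure_display R[i]
  (g_sigma_preimageU (@complex.Re R) (@complex.Im R)) C_set0 C_setC C_bigcup.

End complex_measurable.

(* The real-valued modulus; `|z| itself lives in R[i]. *)
Definition modulus (R : realType) (z : R[i]) : R := complex.Re `|z|.

(* Laws are compared on measurable sets only. *)
Definition equidistributed (R : realType) d d1 d2 (T1 : measurableType d1)
    (T2 : measurableType d2) (U : measurableType d)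
    (P1 : probability T1 R) (X1 : T1 -> U)
    (P2 : probability T2 R) (X2 : T2 -> U) : Prop :=
  forall B : set U, measurable B -> P1 (X1 @^-1` B) = P2 (X2 @^-1` B).

(* sigma k = true stands for the sign +. *)
Definition flip (U : Type) m (sigma : 'I_m -> bool) (x y : m.-tuple U) :
    m.-tuple U :=
  [tuple if sigma k then tnth x k else tnth y k | k < m].

Definition flip_invariant (R : realType) d (T : measurableType d)
    (P : probability T R) m (X Y : T -> m.-tuple R[i]) : Prop :=
  forall sigma tau : 'I_m -> bool,
    equidistributed P (fun w => flip sigma (X w) (Y w))
                    P (fun w => flip tau (X w) (Y w)).

(* X and Y may live on another probability space than lam. *)
Definition property_Theta (R : realType) d (T : measurableType d)
    (P : probability T R) m (lam : T -> m.-tuple R[i]) : Prop :=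
  exists (d' : measure_display) (T' : measurableType d')
         (P' : probability T' R) (X Y : {RV P' >-> m.-tuple R[i]}),
    [/\ equidistributed P' X P lam,
        equidistributed P' Y P lam,
        flip_invariant P' X Y &
        exists a : R[i], forall k : 'I_m,
          {ae P', forall w,
            2^-1 * (modulus (tnth (X w) k - a) + modulus (tnth (Y w) k - a))
            <= modulus (tnth (X w) k - tnth (Y w) k)}].

Definition poly_of_coefs (R : realType) m (l : m.-tuple R[i]) : {poly R[i]} :=
  \sum_(k < m) tnth l k *: 'X^k.

(* lne 0 = -oo, so vanishing coefficients do not contribute. *)
Definition newton_fun (R : realType) m (l : m.-tuple R[i]) (t : R) : \bar R :=
  (\big[maxe/-oo]_(k < m) (lne (modulus (tnth l k))%:E + (k%:R * t)%:E))%E.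

Definition vertex (R : realType) (f : R -> \bar R) (t : R) : Prop :=
  exists c a b : R, [/\ a != b,
    \forall s \near t^'-, f s = (c + a * (s - t))%:E &
    \forall s \near t^'+, f s = (c + b * (s - t))%:E].

Definition nb_vertices (R : realType) m (l : m.-tuple R[i]) : \bar R :=
  counting [set t : R | vertex (newton_fun l) t].

Definition polar_curve (R : realType) (theta : R -> R) : set R[i] :=
  [set z | exists2 r : R, 0 <= r &
     z = ((r * cos (theta r)) +i* (r * sin (theta r)))%C].

Definition log_lipschitz (R : realType) (L : R) (theta : R -> R) : Prop :=
  forall r1 r2 : R, 0 < r1 -> 0 < r2 ->
    `|theta r1 - theta r2| <= L * `|ln (r1 / r2)|.

(* The sum has finite support when p != 0, and is 0 by convention when p = 0. *)
Definition nb_zeros (R : realType) (G : set R[i]) (p : {poly R[i]}) : nat :=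
  \sum_(z \in G) mup z p.

Definition sup_zeros (R : realType) (L : R) (p : {poly R[i]}) : \bar R :=
  ereal_sup [set (nb_zeros (polar_curve theta) p)%:R%:E |
             theta in log_lipschitz L].

(* Main.v *)
Require Import Defs.
From HB Require Import structures.
From mathcomp Require Import all_boot all_order all_algebra.
From mathcomp Require Import all_classical all_reals all_analysis.
From mathcomp Require Import complex.
From mathcomp Require Import measurable_realfun ring lra zify.

Set Implicit Arguments.
Unset Strict Implicit.
Unset Printing Implicit Defensive.

Import Order.TTheory GRing.Theory Num.Theory.
Import numFieldNormedType.Exports.

Local Open Scope classical_set_scope.
Local Open Scope ring_scope.

(* Proof idea. Cover the zeros on a curve by O(log n) cells per vertex of the
   Newton polygon, a cell having diameter a small multiple of the distance to the
   nearest vertex. In a cell with N zeros, dividing out the zeros one at a time in a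
   weighted l^1 norm (a coefficient form of Jensen's inequality) gives
   2^N |P(w)| <= 4 (n + 1) max_k |lambda_k w^k|, so it suffices to find near each cell
   a point w where |P(w)| is at least n^(-O(log n)) times its largest monomial.
   For this take w in a geometric progression z0, q z0, ..., q^(2m-1) z0 with
   m = O(log n). Fix the two vectors x, y of property (Theta) and choose the signs:
   if at least m of the indices k have x_k, y_k far from a, a Turan-type lemma shows
   that on those indices the signs for which P is small along the progression are
   determined by the other ones, so their proportion is at most 2^(-m); if fewer than
   m indices are far, (z - 1) P(z) is nearly a polynomial with at most 2m terms and
   the same lemma shows that P is never small. Flip-invariance turns the average over
   the signs into a probability, and a union bound over polynomially many base points
   z0 finishes the proof. *)

(** Two of the three logarithms come from one cell: the Turan-type lemma loses a factor (al /
    4)^(O(m)), where 1 / al is polynomial in n and m = O(log n), so 2^N <= n^(O(log n)) and N =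
    O(log^2 n). Applied to all n + 1 monomials the same lemma would lose an exponent of order n; the
    signs serve to cut the number of terms down to O(log n). The third logarithm counts cells. Cells
    proportional to the distance to a vertex would shrink to nothing at the vertex, so their
    relative size is a multiple of delta - 1 + 1/n, where delta is the ratio of the radius to the
    critical one (or its inverse). The term 1/n is harmless, because powers up to n change by a
    bounded factor when |z| changes by a relative amount 1/n. On a geometric scale these sizes, from
    about 1/n to about 3, make O(log n) levels. The good event concerns grid points of the plane at
    each crossing scale and never a curve. The Lipschitz condition enters only the deterministic
    part, where it brings together the zeros that one curve has in one annulus; the supremum over
    uncountably many curves therefore costs no probability. *)

Section modulus_theory.
Variable R : realType.
Implicit Types (x y z : R[i]) (r : R).

Lemma modulusC z : (modulus z)%:C%C = `|z|.
Proof. by apply: RRe_real; apply: normr_real. Qed.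

Lemma modulus_ge0 z : 0 <= modulus z.
Proof. by rewrite -ler0c modulusC. Qed.

Lemma modulusM x y : modulus (x * y) = modulus x * modulus y.
Proof. by apply: complexI; rewrite rmorphM /= !modulusC normrM. Qed.

Lemma modulusX x n : modulus (x ^+ n) = modulus x ^+ n.
Proof. by apply: complexI; rewrite rmorphXn /= !modulusC normrX. Qed.

Lemma modulus_real r : modulus r%:C%C = `|r|.
Proof. by rewrite /modulus normc_def /= expr0n addr0 sqrtr_sqr. Qed.

Lemma modulus0 : modulus (0 : R[i]) = 0.
Proof. by rewrite /modulus normr0. Qed.

Lemma modulus1 : modulus (1 : R[i]) = 1.
Proof. by rewrite /modulus normr1. Qed.

Lemma modulus_eq0 z : (modulus z == 0) = (z == 0).
Proof. by rewrite -(inj_eq (@complexI R)) modulusC normr_eq0. Qed.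

Lemma modulus_gt0 z : (0 < modulus z) = (z != 0).
Proof. by rewrite lt_neqAle modulus_ge0 andbT eq_sym modulus_eq0. Qed.

Lemma modulusN z : modulus (- z) = modulus z.
Proof. by rewrite /modulus normrN. Qed.

Lemma modulusB x y : modulus (x - y) = modulus (y - x).
Proof. by rewrite -opprB modulusN. Qed.

Lemma modulus_prod (I : Type) (s : seq I) (F : I -> R[i]) :
  modulus (\prod_(i <- s) F i) = \prod_(i <- s) modulus (F i).
Proof.
elim: s => [|i s IH]; first by rewrite !big_nil modulus1.
by rewrite !big_cons modulusM IH.
Qed.

Lemma le_modulusD x y : modulus (x + y) <= modulus x + modulus y.
Proof. by rewrite -lecR rmorphD /= !modulusC ler_normD. Qed.

Lemma le_modulusB x y : modulus (x - y) <= modulus x + modulus y.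
Proof. by rewrite -(modulusN y) le_modulusD. Qed.

Lemma modulus_triangle x y z : modulus (x - z) <= modulus (x - y) + modulus (y - z).
Proof. by apply: le_trans (le_modulusD _ _); rewrite addrA subrK. Qed.

Lemma le_modulus_sum (I : Type) (s : seq I) (P : pred I) (F : I -> R[i]) :
  modulus (\sum_(i <- s | P i) F i) <= \sum_(i <- s | P i) modulus (F i).
Proof.
elim/big_ind2: _ => [|x a y b xa yb|//]; first by rewrite modulus0.
by apply: le_trans (le_modulusD _ _) _; rewrite lerD.
Qed.

Lemma le_modulusDl x y : modulus x - modulus y <= modulus (x + y).
Proof. by rewrite lerBlDr -{1}[x](addrK y) le_modulusB. Qed.

Lemma le_modulusBl x y : modulus x - modulus y <= modulus (x - y).
Proof. by rewrite -(modulusN y) le_modulusDl. Qed.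

Lemma modulus_ReIm (a b : R) : modulus (a +i* b)%C <= `|a| + `|b|.
Proof.
rewrite /modulus normc_def /= -(ger0_norm (addr_ge0 (normr_ge0 a) (normr_ge0 b))).
rewrite -sqrtr_sqr ler_wsqrtr // -(real_normK (num_real a)) -(real_normK (num_real b)).
have := mulr_ge0 (normr_ge0 a) (normr_ge0 b).
by nra.
Qed.

Lemma Re_le_modulus z : `|complex.Re z| <= modulus z.
Proof.
rewrite /modulus normc_def /= -sqrtr_sqr ler_wsqrtr // lerDl sqr_ge0 //.
Qed.

Lemma Im_le_modulus z : `|complex.Im z| <= modulus z.
Proof.
rewrite /modulus normc_def /= -sqrtr_sqr ler_wsqrtr // lerDr sqr_ge0 //.
Qed.

End modulus_theory.

(** * A Turan-type lower bound for sparse polynomials on a geometric progression *)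

Section turan.
Variables (R : realType) (al : R).
Hypothesis al_gt0 : 0 < al.
Let q := 1 + al.

Let q_ge1 : 1 <= q. Proof. by rewrite /q lerDl ltW. Qed.

Lemma power_gap (i j : nat) : i != j -> al <= `|q ^+ i - q ^+ j|.
Proof.
wlog ij : i j / (i < j)%N.
  move=> H ij; case: (ltngtP i j) ij => // ij _; first by apply: H => //; rewrite ltn_eqF.
  by rewrite distrC; apply: H => //; rewrite ltn_eqF.
move=> _; rewrite distrC -(subnKC ij) addSn exprS exprD.
have h1 : 1 <= q ^+ i by apply: exprn_ege1.
have h2 : 1 <= q ^+ (j - i.+1) by apply: exprn_ege1.
have -> : q * (q ^+ i * q ^+ (j - i.+1)) - q ^+ i =
          q ^+ i * (q * q ^+ (j - i.+1) - 1) by ring.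
have h3 : al <= q * q ^+ (j - i.+1) - 1.
  by rewrite lerBrDl; apply: ler_peMr => //; apply: le_trans q_ge1.
rewrite ger0_norm; last by apply: mulr_ge0; [apply: le_trans h1 | apply: le_trans h3; apply: ltW].
by apply: (le_trans h3); apply: ler_peMl => //; apply: le_trans h3; apply: ltW.
Qed.

(* Passing from f(z) to f(q z) - q^k f(z) removes the k-th monomial. *)
Lemma turan N (z : R[i]) m (c : 'I_N -> R[i]) : al <= 1 -> q ^+ N <= 2 ->
  (#|[set k | c k != 0%R]%SET| <= m)%N -> forall j, c j != 0 ->
  exists2 l, (l < m)%N & modulus (c j) * modulus z ^+ j * (al / 4) ^+ m <=
    modulus (\sum_(k < N) c k * (z * (q ^+ l)%:C%C) ^+ k).
Proof.
move=> al1 qN; have al0 := al_gt0; elim: m c => [|m IH] c cm j cj.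
  by move: cm; rewrite leqn0 cards_eq0 => /eqP /setP /(_ j); rewrite !inE cj.
have [k /andP[kj ck]|none] := pickP (fun k => (k != j) && (c k != 0)); last first.
  exists 0%N => //; rewrite (bigD1 j) //= big1 ?addr0; last first.
    by move=> i ij; have := none i; rewrite ij /= => /negbT; rewrite negbK => /eqP ->; rewrite mul0r.
  rewrite expr0 mulr1 modulusM modulusX; apply: ler_piMr; first by rewrite mulr_ge0 // ?exprn_ge0 // modulus_ge0.
  by apply: exprn_ile1; lra.
pose c' i := c i * (q ^+ i - q ^+ k)%:C%C.
have c'j : c' j != 0.
  rewrite mulf_neq0 // -modulus_eq0 modulus_real gt_eqF //.
  by apply: lt_le_trans al_gt0 _; apply: power_gap; rewrite eq_sym.
have c'm : (#|[set i | c' i != 0%R]%SET| <= m)%N.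
  rewrite -ltnS; apply: leq_trans _ cm; apply: proper_card; apply/properP; split.
    by apply/fintype.subsetP => i; rewrite !inE /c'; apply: contraNneq => ->; rewrite mul0r.
  by exists k; rewrite !inE ?ck // /c' subrr mulr0 eqxx.
have [l lm Hl] := IH c' c'm j c'j.
pose f l := \sum_(i < N) c i * (z * (q ^+ l)%:C%C) ^+ i.
have E : \sum_(i < N) c' i * (z * (q ^+ l)%:C%C) ^+ i = f l.+1 - (q ^+ k)%:C%C * f l.
  rewrite /f mulr_sumr -sumrB; apply: eq_bigr => i _.
  rewrite /c' exprS !rmorphB !rmorphM !rmorphXn /= !exprMn -!exprM.
  by ring.
have qk : q ^+ k <= 2.
  by apply: le_trans qN; apply: ler_weXn2l => //; apply: ltnW.
have qk0 : 0 <= q ^+ k by apply: exprn_ge0; apply: le_trans q_ge1.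
(* [power_gap] gives [c' j] at least al times the modulus of [c j], and q^k <= 2, so one of two
   consecutive samples loses at most a factor al / (1 + 2); 4 replaces 3. *)
have B : modulus (c j) * modulus z ^+ j * (al / 4) ^+ m.+1 <= 4^-1 * (modulus (f l.+1) + 2 * modulus (f l)).
  have : modulus (f l.+1 - (q ^+ k)%:C%C * f l) <= modulus (f l.+1) + 2 * modulus (f l).
    apply: le_trans (le_modulusB _ _) _; rewrite lerD2l modulusM modulus_real ger0_norm //.
    by apply: ler_wpM2r => //; apply: modulus_ge0.
  move: Hl; rewrite E => Hl /(le_trans Hl).
  rewrite /c' modulusM modulus_real => H.
  have H2 : modulus (c j) * al * modulus z ^+ j * (al / 4) ^+ m <= modulus (f l.+1) + 2 * modulus (f l).
    apply: le_trans H; rewrite ler_wpM2r //; first by apply: exprn_ge0; lra.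
    rewrite ler_wpM2r ?exprn_ge0 ?modulus_ge0 // ler_wpM2l ?modulus_ge0 //.
    by apply: power_gap; rewrite eq_sym.
  by move: H2; rewrite exprS; move: ((al / 4) ^+ m) (modulus z ^+ j) => u v; lra.
have [h|h] := lerP (modulus (c j) * modulus z ^+ j * (al / 4) ^+ m.+1) (modulus (f l)).
  by exists l => //; apply: leqW.
exists l.+1; first by rewrite ltnS.
have := modulus_ge0 (f l); rewrite -/(f l.+1).
by move: B h; move: (_ * _ ^+ m.+1) => u; lra.
Qed.

End turan.

(** * A coefficient form of Jensen's inequality on an annulus *)

Section weighted_norm.
Variables (R : realType) (Rp Rm : R) (k : nat).
Implicit Types (p P Q : {poly R[i]}) (zeta w : R[i]).

(* On the annulus [Rm <= |z| <= Rp] the weighted sum of the coefficients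
   dominates [|P z| / |z| ^ k]. *)
Definition weight (j : nat) : R :=
  if (k <= j)%N then Rp ^+ (j - k) else Rm^-1 ^+ (k - j).

Definition wnorm N p : R := \sum_(j < N) modulus p`_j * weight j.

Hypotheses (Rm_gt0 : 0 < Rm) (RmRp : Rm <= Rp).

Let Rp_gt0 : 0 < Rp. Proof. exact: lt_le_trans RmRp. Qed.

Lemma weight_ge0 j : 0 <= weight j.
Proof.
by rewrite /weight; case: ifP => _; apply: exprn_ge0; rewrite ?invr_ge0 ltW.
Qed.

Let weight_lo j : (j < k)%N -> weight j.+1 = Rm * weight j.
Proof.
move=> jk; rewrite /weight (leqNgt k j) jk /= -(subnSK jk) exprS mulrA.
rewrite mulfV ?gt_eqF // mul1r; case: leqP => // kj.
have -> : k = j.+1 by apply/eqP; rewrite eqn_leq kj jk.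
by rewrite subnn !expr0.
Qed.

Let weight_hi j : (k <= j)%N -> weight j.+1 = Rp * weight j.
Proof. by move=> kj; rewrite /weight leqW // kj subSn // exprS. Qed.

Lemma wnorm_ge0 N p : 0 <= wnorm N p.
Proof. by apply: sumr_ge0 => j _; rewrite mulr_ge0 ?modulus_ge0 ?weight_ge0. Qed.

Lemma horner_le_wnorm N p w : (size p <= N)%N -> Rm <= modulus w <= Rp ->
  modulus p.[w] <= modulus w ^+ k * wnorm N p.
Proof.
move=> pN /andP[mw wp]; rewrite (horner_coef_wide _ pN).
apply: le_trans (le_modulus_sum _ _ _) _; rewrite mulr_sumr.
apply: ler_sum => j _; rewrite modulusM modulusX mulrCA ler_wpM2l ?modulus_ge0 //.
have w0 : 0 < modulus w by apply: lt_le_trans mw.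
rewrite /weight; case: leqP => [kj|jk].
  have -> : modulus w ^+ j = modulus w ^+ k * modulus w ^+ (j - k).
    by rewrite -exprD subnKC.
  rewrite ler_wpM2l ?exprn_ge0 ?modulus_ge0 //.
  by rewrite lerXn2r ?nnegrE ?modulus_ge0 // ltW.
have -> : modulus w ^+ k = modulus w ^+ j * modulus w ^+ (k - j).
  by rewrite -exprD subnKC // ltnW.
rewrite -mulrA ler_peMr ?exprn_ge0 ?modulus_ge0 //.
by rewrite -exprMn exprn_ege1 // ler_pdivlMr // mul1r.
Qed.

(** The coefficients of the product are Q_(j-1) - zeta Q_j. Up to index k the second term wins,
    because |zeta| exceeds Rm by s; beyond k the first one wins, because |zeta| is below Rp by s.
    The weighted sums telescope, and the boundary term left at index N - 1 vanishes since Q has no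
    such coefficient. *)
Lemma wnorm_division (s : R) N zeta Q : 0 <= s ->
  modulus zeta + s <= Rp -> Rm + s <= modulus zeta ->
  (size Q < N)%N -> s * wnorm N Q <= wnorm N (('X - zeta%:P) * Q).
Proof.
move=> s0 zp mz QN; pose P := ('X - zeta%:P) * Q; rewrite -/P.
have PE j : P`_j = (if j == 0%N then 0 else Q`_j.-1) - zeta * Q`_j.
  by rewrite /P mulrBl coefB coefXM coefCM.
pose x j := modulus Q`_j; have x0 j : 0 <= x j by apply: modulus_ge0.
have W0 := weight_ge0; have Rp0 := Rp_gt0; have Rm0 := Rm_gt0.
have lo J : (J <= k)%N -> s * wnorm J.+1 Q + Rm * (x J * weight J) <= wnorm J.+1 P.
  rewrite /wnorm; elim: J => [_|J IH Jk]; rewrite big_ord_recr /= [in leRHS]big_ord_recr /=.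
    rewrite !big_ord0 !add0r PE /= sub0r modulusN modulusM -/(x 0%N).
    by have := mulr_ge0 (x0 0%N) (W0 0%N); nra.
  apply: le_trans (lerD (IH (ltnW Jk)) (lexx _)).
  rewrite -/(x J.+1) mulrDr -!addrA lerD2l PE /=.
  have : modulus zeta * x J.+1 - x J <= modulus (Q`_J - zeta * Q`_J.+1).
    by rewrite -modulusM [leRHS]modulusB le_modulusBl.
  move=> /(ler_wpM2r (W0 J.+1)) h.
  apply: le_trans (lerD (lexx _) h).
  rewrite mulrBl [x J * weight J.+1]mulrC weight_lo // .
  by have := mulr_ge0 (x0 J.+1) (W0 J.+1); rewrite weight_lo //; nra.
have hi J : (k <= J)%N -> s * wnorm J.+1 Q - Rp * (x J * weight J) <= wnorm J.+1 P.
  elim: J => [|J IH]; last rewrite leq_eqVlt => /predU1P[kJ|kJ].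
  - rewrite leqn0 => /eqP k0; apply: le_trans (lo 0%N _); last by rewrite k0.
    by have := mulr_ge0 (x0 0%N) (W0 0%N); nra.
  - apply: le_trans (lo J.+1 _); last by rewrite kJ.
    by have := mulr_ge0 (x0 J.+1) (W0 J.+1); nra.
  rewrite /wnorm big_ord_recr /= [in leRHS]big_ord_recr /=.
  apply: le_trans (lerD (IH kJ) (lexx _)).
  rewrite -/(x J.+1) mulrDr -!addrA lerD2l PE /=.
  have : x J - modulus zeta * x J.+1 <= modulus (Q`_J - zeta * Q`_J.+1).
    by rewrite -modulusM le_modulusBl.
  move=> /(ler_wpM2r (W0 J.+1)) h.
  apply: le_trans (lerD (lexx _) h).
  rewrite mulrBl [x J * weight J.+1]mulrC weight_hi //.
  by have := mulr_ge0 (x0 J.+1) (W0 J.+1); rewrite weight_hi //; nra.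
case: N QN => // J QJ.
have xJ : x J = 0 by rewrite /x nth_default // modulus0.
have [kJ|Jk] := leqP k J.
  by have := hi J kJ; rewrite xJ mul0r mulr0 subr0.
by have := lo J (ltnW Jk); rewrite xJ mul0r mulr0 addr0.
Qed.

(** Each root contributes at least s to the norm but at most s / 2 to the value at w; the
    discrepancy is a factor 2 per root. *)
Lemma root_count_bound (s : R) N (rs : seq R[i]) Q w : 0 < s ->
  (forall zeta, zeta \in rs -> [/\ modulus zeta + s <= Rp, Rm + s <= modulus zeta &
     modulus (w - zeta) <= s / 2]) ->
  Rm <= modulus w <= Rp -> Q != 0 ->
  let P := \prod_(zeta <- rs) ('X - zeta%:P) * Q in
  (size P <= N)%N ->
  2 ^+ size rs * modulus P.[w] <= modulus w ^+ k * wnorm N P.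
Proof.
move=> s0 hrs hw Q0 P PN.
have szP (t : seq R[i]) : size (\prod_(zeta <- t) ('X - zeta%:P) * Q) = (size t + size Q)%N.
  rewrite size_mul ?Q0 ?monic_neq0 ?monic_prod_XsubC //.
  by rewrite size_prod_XsubC addSn.
have QN : (size Q <= N)%N.
  by apply: (leq_trans _ PN); rewrite /P szP leq_addl.
have h1 : s ^+ size rs * wnorm N Q <= wnorm N P.
  rewrite /P; move: PN; rewrite /P szP.
  elim: {P} rs hrs => [|z t IH] hrs tN; first by rewrite big_nil !mul1r.
  rewrite big_cons -mulrA /= exprS -mulrA.
  have /hrs[h2 h3 _] : z \in z :: t by rewrite mem_head.
  have tN' : (size t + size Q < N)%N by move: tN; rewrite /= addSn.
  apply: le_trans (wnorm_division (ltW s0) h2 h3 _); last by rewrite szP.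
  apply: (ler_wpM2l (ltW s0)); apply: IH; last exact: ltnW.
  by move=> y yt; apply: hrs; rewrite inE yt orbT.
have h2 : modulus P.[w] <= (s / 2) ^+ size rs * modulus Q.[w].
  rewrite /P hornerM modulusM ler_wpM2r ?modulus_ge0 // horner_prod modulus_prod.
  elim: rs {P PN h1} hrs => [|z t IH] hrs; first by rewrite big_nil.
  rewrite big_cons /= exprS hornerXsubC.
  have /hrs[_ _ h3] : z \in z :: t by rewrite mem_head.
  apply: ler_pM => //; rewrite ?modulus_ge0 //.
    by apply: prodr_ge0 => i _; apply: modulus_ge0.
  by apply: IH => y yt; apply: hrs; rewrite inE yt orbT.
have h3 := horner_le_wnorm QN hw.
apply: le_trans (ler_wpM2l _ h2) _; first by rewrite exprn_ge0.
rewrite mulrA -exprMn; have -> : 2 * (s / 2) = s by field.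
apply: (le_trans (ler_wpM2l (exprn_ge0 _ (ltW s0)) h3)).
by rewrite mulrCA ler_wpM2l // exprn_ge0 ?modulus_ge0.
Qed.

End weighted_norm.

(** * Counting the sign patterns for which the polynomial is small on a progression *)

Section sign_counting.
Variables (R : realType) (n m : nat) (al : R).
Hypotheses (al_gt0 : 0 < al) (al_le1 : al <= 1) (m_gt0 : (0 < m)%N)
  (al_small : (1 + al) ^+ (2 * m * n.+2) <= 2).

Definition sample (al : R) (z : R[i]) (l : nat) : R[i] := z * ((1 + al) ^+ l)%:C%C.

Definition value (c : 'I_n.+1 -> R[i]) (z : R[i]) : R[i] := \sum_(k < n.+1) c k * z ^+ k.

Let beta := al / 4.
(** Relative size below which a deviation from a is neglected. The near case ends with (al / 4)^(2m)
    <= 7 eta (n + 2)^2, which the constant 24 contradicts. *)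
Definition smallness (al : R) : R := (al / 4) ^+ (2 * m) / (24 * n.+2%:R ^+ 2).
(** Makes 2 tau W equal to (al / 4)^m (eta W / 2), the lower bound that [turan] gives for a
    difference of two flat polynomials. *)
Definition threshold (al : R) : R := (al / 4) ^+ m * smallness al / 4.
Let eta := smallness al.
Let tau := threshold al.

Let q_ge1 : 1 <= 1 + al. Proof. by rewrite lerDl ltW. Qed.

Let beta_gt0 : 0 < beta. Proof. exact: divr_gt0. Qed.

Let eta_gt0 : 0 < eta.
Proof. by rewrite divr_gt0 ?exprn_gt0 ?beta_gt0 // mulr_gt0 // exprn_gt0 // ltr0n. Qed.

Let tau_gt0 : 0 < tau.
Proof. by rewrite divr_gt0 ?mulr_gt0 ?exprn_gt0 ?beta_gt0. Qed.

Lemma modulus_sample z l : modulus (sample al z l) = modulus z * (1 + al) ^+ l.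
Proof.
by rewrite modulusM modulus_real ger0_norm // exprn_ge0 // (le_trans ler01).
Qed.

Lemma modulus_sampleX z l k : (l < 2 * m)%N -> (k <= n.+2)%N ->
  modulus z ^+ k <= modulus (sample al z l) ^+ k <= 2 * modulus z ^+ k.
Proof.
move=> lm kn; rewrite modulus_sample exprMn -exprM [2 * _]mulrC.
rewrite ler_peMr ?exprn_ge0 ?modulus_ge0 ?exprn_ege1 //=.
rewrite ler_wpM2l ?exprn_ge0 ?modulus_ge0 //.
apply: le_trans al_small; apply: ler_weXn2l => //.
by apply: leq_mul => //; apply: ltnW.
Qed.

Let al_Turan N : (N <= n.+2)%N -> (1 + al) ^+ N <= 2.
Proof.
move=> Nn; apply: le_trans al_small; apply: ler_weXn2l => //.
by apply: leq_trans Nn _; rewrite leq_pmull // muln_gt0.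
Qed.

(** Existential in i, so that the negation supplies a large sample for every monomial, in particular
    for a dominating one chosen afterwards. *)
Definition poorly_spread (al : R) (c : 'I_n.+1 -> R[i]) (z : R[i]) : bool :=
  [exists i, [forall l : 'I_(2 * m),
    modulus (value c (sample al z l)) < threshold al * (modulus (c i) * modulus z ^+ i)]].

Variables (x y : 'I_n.+1 -> R[i]) (a z : R[i]).
Hypothesis Theta : forall k,
  2^-1 * (modulus (x k - a) + modulus (y k - a)) <= modulus (x k - y k).

Definition mixed (x y : 'I_n.+1 -> R[i]) (S : {set 'I_n.+1}) k : R[i] :=
  if k \in S then x k else y k.

Let mix := mixed x y.
(** The level W is decoupled from the pattern, so that two patterns can be compared at the same
    level. *)
Let flat (W : R) : {set {set 'I_n.+1}} :=
  [set S | [forall l : 'I_(2 * m), modulus (value (mix S) (sample al z l)) < tau * W]]%SET.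
Let far (W : R) : {set 'I_n.+1} :=
  [set k | (eta * W <= Num.max (modulus (x k - a)) (modulus (y k - a)) * modulus z ^+ k)%R]%SET.

Let Theta_max k : Num.max (modulus (x k - a)) (modulus (y k - a)) <= 2 * modulus (x k - y k).
Proof.
have := Theta k; have := modulus_ge0 (x k - a); have := modulus_ge0 (y k - a).
by rewrite ge_max => *; apply/andP; split; lra.
Qed.

Let flatP W S l : S \in flat W -> (l < 2 * m)%N ->
  modulus (value (mix S) (sample al z l)) < tau * W.
Proof. by rewrite inE => /forallP h lm; apply: (h (Ordinal lm)). Qed.

Let flat_gt0 W S : S \in flat W -> 0 < W.
Proof.
move=> SW; rewrite -(pmulr_rgt0 _ tau_gt0).
have l0 : (0 < 2 * m)%N by rewrite muln_gt0.
exact: le_lt_trans (modulus_ge0 _) (flatP SW l0).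
Qed.

(* The difference of two flat polynomials with the same coefficients outside m
   indices where x and y are far apart contradicts [turan]. *)
Let card_flat_far W : (m <= #|far W|)%N -> (#|flat W| * 2 ^ m <= 2 ^ n.+1)%N.
Proof.
move=> mK; pose K' := [set k in take m (enum (far W))]%SET.
have cK' : #|K'| = m.
  rewrite cardsE; have /card_uniqP -> : uniq (take m (enum (far W))).
    by rewrite take_uniq ?enum_uniq.
  by rewrite size_takel // -cardE.
have K'K k : k \in K' -> k \in far W.
  by rewrite inE => /mem_take; rewrite mem_enum.
have inj : {in flat W &, injective (fun S => S :\: K')}.
  move=> S S' SW S'W /setP e; apply/setP => j; apply/eqP/negPn/negP => jSS'.
  have jK' : j \in K'.
    by apply: contraR jSS' => jK; have := e j; rewrite !finset.in_setD jK /= => ->.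
  pose c k := mix S k - mix S' k.
  have cj : modulus (c j) = modulus (x j - y j).
    move: jSS'; rewrite /c /mix /mixed; case: (j \in S); case: (j \in S') => //= _.
    by rewrite modulusB.
  have W0 := flat_gt0 SW.
  have big : eta * W / 2 <= modulus (c j) * modulus z ^+ j.
    have := K'K _ jK'; rewrite inE cj => h.
    have : Num.max (modulus (x j - a)) (modulus (y j - a)) * modulus z ^+ j <= 2 * modulus (x j - y j) * modulus z ^+ j.
      by rewrite ler_wpM2r ?exprn_ge0 ?modulus_ge0.
    by lra.
  have cj0 : c j != 0.
    rewrite -modulus_gt0 lt_neqAle modulus_ge0 andbT; apply/eqP => c0.
    move: big; rewrite -c0 mul0r; have := mulr_gt0 eta_gt0 W0; lra.
  have supp : (#|[set k | c k != 0%R]%SET| <= m)%N.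
    rewrite -cK'; apply: subset_leq_card; apply/fintype.subsetP => k; rewrite inE.
    apply: contraNT => kK; rewrite /c /mix /mixed.
    have := e k; rewrite !finset.in_setD kK /= => ->; by rewrite subrr.
  have [l lm] := turan al_gt0 z al_le1 (al_Turan (leqnSn _)) supp cj0.
  rewrite leNgt => /negP; apply.
  have l2m : (l < 2 * m)%N by apply: leq_trans lm _; rewrite leq_pmull.
  have -> : \sum_(k < n.+1) c k * (z * ((1 + al) ^+ l)%:C%C) ^+ k =
     value (mix S) (sample al z l) - value (mix S') (sample al z l).
    by rewrite /value -sumrB; apply: eq_bigr => k _; rewrite -mulrBl.
  apply: le_lt_trans (le_modulusB _ _) _.
  have h1 := flatP SW l2m; have h2 := flatP S'W l2m.
  apply: (@lt_le_trans _ _ (2 * (tau * W))); first lra.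
  have -> : 2 * (tau * W) = eta * W / 2 * beta ^+ m by rewrite /tau /threshold -/eta -/beta; field.
  by rewrite ler_wpM2r // exprn_ge0 // ltW.
rewrite -(card_in_imset inj).
have : (#|[set S :\: K' | S in flat W]%SET| <= 2 ^ (n.+1 - m))%N.
  have <- : #|~: K'| = (n.+1 - m)%N by rewrite cardsCs finset.setCK card_ord cK'.
  rewrite -card_powerset; apply: subset_leq_card; apply/fintype.subsetP => _ /imsetP[S _ ->].
  by rewrite powersetE finset.setDE finset.subsetIr.
have mn : (m <= n.+1)%N by rewrite -cK'; have := max_card K'; rewrite card_ord.
by move=> h; rewrite -[leqRHS](_ : 2 ^ (n.+1 - m) * 2 ^ m = _)%N ?leq_mul2r ?h ?orbT // -expnD subnK.
Qed.

(* If x and y are close to a at all but fewer than m indices, then (z - 1) P(z) is,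
   up to a small error, supported on at most 2 m indices. *)
Let flat_near W S i : (#|far W| < m)%N -> S \in flat W ->
  modulus (mix S i) * modulus z ^+ i = W -> False.
Proof.
move=> Km SW iW; have W0 := flat_gt0 SW.
pose K := far W; pose c := mix S.
have near k : k \notin K -> modulus (c k - a) * modulus z ^+ k <= eta * W.
  rewrite inE -ltNge => /ltW; apply: le_trans.
  rewrite ler_wpM2r ?exprn_ge0 ?modulus_ge0 // /c /mix /mixed le_max.
  by case: ifP => _; rewrite lexx ?orbT.
(* [g] replaces the near coefficients by a and is 0 beyond n; [f] lists the coefficients of X - 1
   times the polynomial of [g], so consecutive near indices cancel. *)
pose g k : R[i] := if (k < n.+1)%N then (if inord k \in K then c (inord k) else a) else 0.
pose f j : R[i] := (if j == 0%N then 0 else g j.-1) - g j.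
have gS : g n.+1 = 0 by rewrite /g ltnn.
have gE (k : 'I_n.+1) : g k = if k \in K then c k else a.
  by rewrite /g ltn_ord inord_val.
have sumf J : \sum_(j < J.+1) f j = - g J.
  elim: J => [|J IH]; first by rewrite big_ord1 /f sub0r.
  by rewrite big_ord_recr /= IH /f /=; ring.
(* The two ends, and two indices for each of the at most m - 1 far ones: 2 + 2 (m - 1) = 2 m, whence
   the 2 m samples. *)
have supp : (#|[set j : 'I_n.+2 | f j != 0%R]%SET| <= 2 * m)%N.
  pose T := ([set ord0; ord_max] :|: (widen_ord (leqnSn n.+1) @: K :|: (lift ord0 @: K)))%SET.
  apply: (@leq_trans #|T|).
    apply: subset_leq_card; apply/fintype.subsetP => j; rewrite !inE; apply: contraR.
    rewrite !negb_or -!andbA => /and4P[j0 jn jK jK1].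
    have j0' : (0 < j)%N by rewrite lt0n.
    have jn' : (j < n.+1)%N by rewrite ltn_neqAle -ltnS ltn_ord andbT.
    have jn1 : (j.-1 < n.+1)%N by apply: leq_ltn_trans jn'; rewrite leq_pred.
    rewrite /f; have /negbTE-> : (j : nat) != 0%N by rewrite -lt0n.
    rewrite (gE (Ordinal jn')) -[j.-1]/(val (Ordinal jn1)) gE.
    case: ifPn => [jj|_].
      case/negP: jK1; apply/imsetP; exists (Ordinal jn1) => //.
      by apply/val_inj; rewrite /= /bump /= add1n prednK.
    case: ifPn => [jj|_]; last by rewrite subrr.
    by case/negP: jK; apply/imsetP; exists (Ordinal jn') => //; apply/val_inj.
  apply: leq_trans (leq_card_setU _ _) _.
  have Km1 : (#|K| <= m.-1)%N by rewrite -ltnS prednK.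
  apply: (@leq_trans (2 + (m.-1 + m.-1))); last by move: m_gt0 => /=; clear; lia.
  apply: leq_add; first by rewrite cards2; case: eqP.
  apply: leq_trans (leq_card_setU _ _) _.
  by apply: leq_add; apply: leq_trans (leq_imset_card _ _) Km1.
(* Bounds the polynomial of [g] at each sample: flatness gives tau W, and each of the at most n + 1
   replaced coefficients an error 2 eta W. *)
pose D := (tau + 2 * n.+1%:R * eta) * W.
have D0 : 0 <= D.
  apply: (mulr_ge0 _ (ltW W0)); apply: (addr_ge0 (ltW tau_gt0)).
  by apply: (mulr_ge0 _ (ltW eta_gt0)); apply: mulr_ge0.
have z0 := modulus_ge0 z; have eW0 := ltW (mulr_gt0 eta_gt0 W0).
have fB (j : 'I_n.+2) : modulus (f j) * modulus z ^+ j * beta ^+ (2 * m) <= (2 * modulus z + 1) * D.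
  have [fj0|fj] := eqVneq (f j) 0.
    by rewrite fj0 modulus0 !mul0r mulr_ge0 //; lra.
  have [l lm h] := @turan _ _ al_gt0 n.+2 z _ (fun j => f j) al_le1 (al_Turan (leqnn _)) supp j fj.
  apply: le_trans h _.
  pose w := sample al z l.
  have -> : \sum_(k < n.+2) f k * (z * ((1 + al) ^+ l)%:C%C) ^+ k =
    (w - 1) * \sum_(k < n.+1) g k * w ^+ k.
    rewrite -/(sample al z l) -/w /f.
    under eq_bigr do rewrite mulrBl.
    rewrite sumrB big_ord_recl /= mul0r add0r [X in _ - X]big_ord_recr /= gS mul0r addr0.
    rewrite mulrBl mul1r mulr_sumr; congr (_ - _); apply: eq_bigr => k _.
    by rewrite /bump /= add1n exprS mulrCA.
  rewrite modulusM; apply: ler_pM; rewrite ?modulus_ge0 //.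
    apply: le_trans (le_modulusB _ _) _; rewrite modulus1 lerD2r.
    by have /andP[_] := modulus_sampleX z lm (isT : (1 <= n.+2)%N); rewrite !expr1.
  have -> : \sum_(k < n.+1) g k * w ^+ k = value c w - \sum_(k < n.+1 | k \notin K) (c k - a) * w ^+ k.
    rewrite /value [X in _ - X]big_mkcond /= -sumrB; apply: eq_bigr => k _; rewrite gE.
    by case: ifP => _ /=; rewrite ?subr0 // mulrBl opprB addrC subrK.
  apply: le_trans (le_modulusB _ _) _; rewrite /D mulrDl lerD //.
    exact: ltW (flatP SW lm).
  apply: le_trans (le_modulus_sum _ _ _) _.
  apply: (@le_trans _ _ (\sum_(k < n.+1 | k \notin K) 2 * (eta * W))).
    apply: ler_sum => k kK; rewrite modulusM modulusX.
    have kn : (k <= n.+2)%N by apply: ltnW; apply: ltnW; rewrite ltnS.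
    have /andP[_ h1] := modulus_sampleX z lm kn.
    apply: le_trans (ler_wpM2l (modulus_ge0 _) h1) _.
    by rewrite mulrCA ler_wpM2l // near.
  rewrite big_mkcond /=; apply: (@le_trans _ _ (\sum_(k < n.+1) 2 * (eta * W))).
    by apply: ler_sum => k _; case: ifP => // _; rewrite mulr_ge0.
  by rewrite sumr_const card_ord -mulr_natl; lra.
have b0 : 0 <= beta ^+ (2 * m) by rewrite exprn_ge0 // ltW.
have gB : modulus (g i) * modulus z ^+ i * beta ^+ (2 * m) <= n.+2%:R * (3 * D).
  have sumB (s : pred 'I_n.+2) : \sum_(j < n.+2 | s j) modulus (f j) * modulus z ^+ j * beta ^+ (2 * m)
      <= n.+2%:R * ((2 * modulus z + 1) * D).
    apply: (@le_trans _ _ (\sum_(j < n.+2 | s j) (2 * modulus z + 1) * D)).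
      by apply: ler_sum => j _.
    rewrite big_mkcond /=; apply: (@le_trans _ _ (\sum_(j < n.+2) (2 * modulus z + 1) * D)).
      by apply: ler_sum => j _; case: ifP => // _; rewrite mulr_ge0 //; lra.
    by rewrite sumr_const card_ord -[leLHS]mulr_natl.
  have gi : g i = - \sum_(j < n.+2 | (j <= i)%N) f j.
    rewrite -[LHS]opprK -sumf; congr (- _).
    by rewrite (big_ord_widen_cond n.+2 predT f) // ltnS ltnW.
  (* Since [f] sums to 0, [g i] is up to sign the sum of [f] over the indices up to i, or over those
     beyond i. The side is chosen so that powers of |z| may be exchanged termwise; for |z| > 1 the
     spare factor |z| absorbs 2 |z| + 1 <= 3 |z|. *)
  have [z1|z1] := lerP (modulus z) 1.
    apply: le_trans (_ : n.+2%:R * ((2 * modulus z + 1) * D) <= _); last first.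
      by rewrite ler_wpM2l // ler_wpM2r //; lra.
    apply: le_trans (sumB (fun j => (j <= i)%N)).
    rewrite -!mulr_suml ler_wpM2r // gi modulusN.
    apply: le_trans (ler_wpM2r (exprn_ge0 _ z0) (le_modulus_sum _ _ _)) _.
    rewrite mulr_suml; apply: ler_sum => j ji; rewrite ler_wpM2l ?modulus_ge0 //.
    by apply: ler_wiXn2l.
  have gi' : g i = \sum_(j < n.+2 | ~~ (j <= i)%N) f j.
    rewrite gi; apply/eqP; rewrite eq_sym -subr_eq0 opprK addrC.
    by rewrite -(bigID (fun j : 'I_n.+2 => (j <= i)%N) predT f) /= sumf gS oppr0.
  rewrite -(ler_pM2l (lt_trans ltr01 z1)).
  apply: le_trans (_ : n.+2%:R * ((2 * modulus z + 1) * D) <= _); last first.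
    by rewrite [leRHS]mulrCA ler_wpM2l // [leRHS]mulrA ler_wpM2r //; lra.
  apply: le_trans (sumB (fun j => ~~ (j <= i)%N)).
  have -> : modulus z * (modulus (g i) * modulus z ^+ i * beta ^+ (2 * m)) =
      modulus z ^+ i.+1 * modulus (g i) * beta ^+ (2 * m) by rewrite exprS; ring.
  rewrite -!mulr_suml ler_wpM2r // gi'.
  apply: le_trans (ler_wpM2l (exprn_ge0 _ z0) (le_modulus_sum _ _ _)) _.
  rewrite mulr_sumr; apply: ler_sum => j ji; rewrite mulrC ler_wpM2l ?modulus_ge0 //.
  by apply: ler_weXn2l; [exact: ltW | rewrite ltnNge].
have cB : W <= modulus (g i) * modulus z ^+ i + eta * W.
  rewrite -{1}iW -/c gE; case: ifPn => iK; first by rewrite lerDl.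
  have h1 : modulus (c i) <= modulus (c i - a) + modulus a.
    by rewrite -{1}[c i](subrK a) le_modulusD.
  by have := ler_wpM2r (exprn_ge0 i z0) h1; rewrite mulrDl; have := near _ iK; lra.
pose b := beta ^+ (2 * m); pose N : R := n.+2%:R.
have N1 : 2 <= N by rewrite ler_nat.
have bp : 0 < b by rewrite exprn_gt0.
have b1 : b <= 1.
  by rewrite exprn_ile1 ?(ltW beta_gt0) // /beta; have := al_le1; lra.
have t1 : tau <= eta / 4.
  rewrite /tau /threshold -/beta -/eta ler_wpM2r // ler_piMl ?(ltW eta_gt0) //.
  by rewrite exprn_ile1 ?(ltW beta_gt0) // /beta; have := al_le1; lra.
have e1 : eta * (24 * N ^+ 2) = b.
  by rewrite /eta /smallness -/beta -/b divfK // mulf_neq0 // expf_neq0 // pnatr_eq0.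
have nN : n.+1%:R = N - 1 by rewrite /N -[n.+2%:R]natr1 addrK.
have e0 := eta_gt0; have w0 := W0.
have h1 : W * b <= n.+2%:R * (3 * D) + eta * W * b.
  have : W * b <= (modulus (g i) * modulus z ^+ i + eta * W) * b by rewrite ler_wpM2r.
  by rewrite mulrDl => h; apply: (le_trans h); rewrite lerD2r.
have h2 : b <= N * 3 * (tau + 2 * n.+1%:R * eta) + eta * b.
  rewrite -(ler_pM2l w0); apply: le_trans h1 _; rewrite /D -/N.
  by rewrite le_eqVlt; apply/orP; left; apply/eqP; ring.
move: h2; rewrite nN => h2.
have h3 : N * 3 * (tau + 2 * (N - 1) * eta) <= 6 * (eta * N ^+ 2).
  have : N * 3 * tau <= N * 3 * (eta / 4) by rewrite ler_wpM2l //; lra.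
  have : 0 <= N * eta by rewrite mulr_ge0 ?ltW //; lra.
  lra.
have h4 : eta * b <= eta * N ^+ 2 by rewrite ler_wpM2l ?ltW //; nra.
by lra.
Qed.

(** The size of the i-th monomial depends on the pattern only through the sign at i, so 2 (n + 1)
    levels W occur. At each level there are either m far indices, which bounds the number of flat
    patterns, or fewer, which excludes all those that attain W. *)
Lemma card_poorly_spread :
  (#|[set S | poorly_spread al (mixed x y S) z]%SET| * 2 ^ m <= 2 * n.+1 * 2 ^ n.+1)%N.
Proof.
pose W (p : 'I_n.+1 * bool) := modulus (if p.2 then x p.1 else y p.1) * modulus z ^+ p.1.
pose F p := ([set S in flat (W p) | (p.1 \in S) == p.2])%SET.
have FB p : (#|F p| * 2 ^ m <= 2 ^ n.+1)%N.
  have FW : F p \subset flat (W p) by apply/fintype.subsetP => S; rewrite inE => /andP[].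
  have [h|h] := leqP m #|far (W p)|.
    by apply: leq_trans (card_flat_far h); rewrite leq_mul2r subset_leq_card // orbT.
  suff -> : F p = finset.set0 by rewrite cards0.
  apply/eqP; rewrite -finset.subset0; apply/fintype.subsetP => S; rewrite inE => /andP[SW /eqP pS].
  by case: (flat_near (i := p.1) h SW); rewrite /W /mix /mixed pS.
have sub : ([set S | poorly_spread al (mixed x y S) z] \subset \bigcup_p F p)%SET.
  apply/fintype.subsetP => S; rewrite inE => /existsP[i Hi]; apply/finset.bigcupP.
  exists (i, i \in S) => //; rewrite !inE eqxx andbT.
  by move: Hi; rewrite /W /= /mixed.
apply: leq_trans (leq_mul (subset_leq_card sub) (leqnn _)) _.
apply: (@leq_trans (\sum_(p : 'I_n.+1 * bool) #|F p| * 2 ^ m)%N).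
  rewrite -big_distrl leq_mul2r; apply/orP; right.
  elim/big_rec2: _ => [|p k A _ h]; first by rewrite cards0.
  by apply: leq_trans (leq_card_setU _ _) _; rewrite leq_add2l.
apply: (@leq_trans (\sum_(p : 'I_n.+1 * bool) 2 ^ n.+1)%N).
  by apply: leq_sum => p _; apply: FB.
by rewrite sum_nat_const card_prod card_bool card_ord (mulnC 2).
Qed.

End sign_counting.

(** * Where a line leaves the upper envelope of a finite family *)

Section upper_envelope.
Variables (R : realType) (I : finType) (A : pred I) (b s : I -> R).

(** Among the lines above line k at t1, the one that crosses it first is the witness: no other line
    can have overtaken k earlier. The slopes are arbitrary reals, so that time can be reversed by
    negating them, as [critical_below] does. *)
Lemma envelope_leaves (k j : I) (t0 t1 : R) : t0 < t1 ->
  (forall i, A i -> b i + s i * t0 <= b k + s k * t0) ->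
  A j -> b k + s k * t1 < b j + s j * t1 ->
  exists2 t, t0 <= t < t1 & exists j', [/\ A j', s j' != s k,
    b j' + s j' * t = b k + s k * t &
    forall i, A i -> b i + s i * t <= b k + s k * t].
Proof.
move=> t01 k0 Aj j1; pose B i := A i && (b k + s k * t1 < b i + s i * t1).
pose cross i := (b i - b k) / (s k - s i).
have slope i t : A i -> t0 <= t -> b k + s k * t < b i + s i * t -> s k < s i.
  move=> Ai tt h; have h0 := k0 i Ai; rewrite ltNge; apply/negP => sik.
  have : s i * (t - t0) <= s k * (t - t0) by rewrite ler_wpM2r // subr_ge0.
  by lra.
have cross_gt i t : s k < s i -> (cross i < t) = (b k + s k * t < b i + s i * t).
  move=> ki; rewrite /cross.
  have -> : (b i - b k) / (s k - s i) = (b k - b i) / (s i - s k).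
    by field; rewrite subr_eq0 gt_eqF //= subr_eq0 lt_eqF.
  by rewrite ltr_pdivrMr ?subr_gt0 // -subr_gt0 -[RHS]subr_gt0; congr (0 < _); ring.
have Bj : B j by rewrite /B Aj j1.
pose j' := [arg min_(i < j | B i) cross i]%O.
have [Bj' minj'] : B j' /\ forall i, B i -> cross j' <= cross i.
  by rewrite /j'; case: Order.TotalTheory.arg_minP.
have /andP[Aj' j'1] := Bj'.
have sj' : s k < s j' by apply: slope j'1 => //; exact: ltW.
pose t := cross j'; exists t; last exists j'; last split => //.
- rewrite cross_gt // j'1 andbT leNgt cross_gt // -leNgt; exact: k0.
- by rewrite gt_eqF.
- rewrite /t /cross; field; by rewrite lt_eqF // subr_lt0.
have t0t : t0 <= t by rewrite leNgt cross_gt // -leNgt; exact: k0.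
move=> i Ai; rewrite leNgt; apply/negP => it.
have ki := slope _ _ Ai t0t it.
have tt1 : t < t1 by rewrite cross_gt.
have Bi : B i by rewrite /B Ai -cross_gt // (lt_trans _ tt1) // cross_gt.
by have := minj' _ Bi; rewrite leNgt cross_gt // it.
Qed.

End upper_envelope.

(** * Critical radii, vertices of the Newton polygon, and the zeros near them *)

Section newton_polygon.
Variables (R : realType) (n : nat) (l : n.+1.-tuple R[i]).
Hypothesis l0 : tnth l ord0 != 0.

Definition term (l : n.+1.-tuple R[i]) (k : 'I_n.+1) (r : R) : R := modulus (tnth l k) * r ^+ k.
Definition active (l : n.+1.-tuple R[i]) (k : 'I_n.+1) (r : R) : bool :=
  [forall i, term l i r <= term l k r].
Definition critical (l : n.+1.-tuple R[i]) (r : R) : bool :=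
  [exists j : 'I_n.+1, exists k : 'I_n.+1, [&& (j < k)%N, active l j r & active l k r]].
(** The solution r of |l_j| r^j = |l_k| r^k when j and k differ and both coefficients are nonzero.
    In every other case it is still a positive number, and it always depends on these two
    coefficients alone. *)
Definition crossing (l : n.+1.-tuple R[i]) (j k : 'I_n.+1) : R :=
  expR ((ln (modulus (tnth l j)) - ln (modulus (tnth l k))) / (k%:R - j%:R)).

Lemma active_neq0 k r : 0 < r -> active l k r -> 0 < modulus (tnth l k).
Proof.
move=> r0 /forallP /(_ ord0); rewrite /term expr0 mulr1 => h.
have : 0 < modulus (tnth l k) * r ^+ k by apply: lt_le_trans h; rewrite modulus_gt0.
by rewrite pmulr_lgt0 // exprn_gt0.
Qed.

Lemma exists_active r : exists k, active l k r.
Proof.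
exists [arg max_(i > ord0) term l i r]%O; case: Order.TotalTheory.arg_maxP => // i _ h.
by apply/forallP => j; apply: h.
Qed.

Let line k t : R := ln (modulus (tnth l k)) + k%:R * t.

Lemma term_line k r : 0 < r -> 0 < modulus (tnth l k) ->
  term l k r = expR (line k (ln r)).
Proof.
move=> r0 k0; by rewrite /term expRD expRM_natl !lnK ?posrE.
Qed.

Let A k := 0 < modulus (tnth l k).

Lemma activeP k r : 0 < r -> A k ->
  reflect (forall i, A i -> line i (ln r) <= line k (ln r)) (active l k r).
Proof.
move=> r0 Ak; apply: (iffP forallP) => h i.
  by move=> Ai; rewrite -ler_expR -!term_line.
have [i0|Ai] := leP (modulus (tnth l i)) 0; last by rewrite !term_line // ler_expR h.
have e : modulus (tnth l i) = 0 by apply/eqP; rewrite eq_le i0 modulus_ge0.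
by rewrite /term e mul0r mulr_ge0 ?modulus_ge0 // exprn_ge0 // ltW.
Qed.

Lemma critical_crossing r : 0 < r -> critical l r ->
  exists j k : 'I_n.+1, r = crossing l j k.
Proof.
move=> r0 /existsP[j /existsP[k /and3P[jk aj ak]]]; exists j, k.
have Aj := active_neq0 r0 aj; have Ak := active_neq0 r0 ak.
have e : line j (ln r) = line k (ln r).
  by apply/le_anti/andP; split; [exact: (activeP r0 Ak ak) | exact: (activeP r0 Aj aj)].
have kj : k%:R - j%:R != 0 :> R by rewrite subr_eq0 eqr_nat gtn_eqF.
apply: ln_inj; rewrite ?posrE ?expR_gt0 // /crossing expRK.
apply: (mulIf kj); rewrite divfK //; move: e; rewrite /line; lra.
Qed.

Let pair_critical j k r : 0 < r -> j != k -> active l j r -> active l k r -> critical l r.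
Proof.
move=> r0 jk aj ak; apply/existsP; case: (ltngtP j k) => h.
- by exists j; apply/existsP; exists k; rewrite h aj.
- by exists k; apply/existsP; exists j; rewrite h aj ak.
- by move: jk; rewrite (val_inj h) eqxx.
Qed.

Lemma critical_above k r0 r1 : 0 < r0 -> r0 < r1 -> active l k r0 -> ~~ active l k r1 ->
  exists2 r, r0 <= r < r1 & critical l r.
Proof.
move=> p0 r01 a0 /forallPn[j]; rewrite -ltNge => h.
have p1 := lt_trans p0 r01; have Ak := active_neq0 p0 a0.
have Aj : A j.
  have : 0 < term l j r1.
    by apply: le_lt_trans h; rewrite mulr_ge0 ?modulus_ge0 // exprn_ge0 // ltW.
  by rewrite pmulr_lgt0 // exprn_gt0.
have ln01 : ln r0 < ln r1 by rewrite ltr_ln ?posrE.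
move: h; rewrite !term_line // ltr_expR => h.
have [t /andP[t0 t1] [j' [Aj' sj' e ht]]] := @envelope_leaves R _ A
  (fun i => ln (modulus (tnth l i))) (fun i => i%:R) k j _ _ ln01 (activeP p0 Ak a0) Aj h.
exists (expR t).
  by rewrite -[r0]lnK ?posrE // -[r1]lnK ?posrE // ler_expR ltr_expR t0 t1.
have r0' := expR_gt0 t.
apply: (@pair_critical j' k) => //.
- by apply: contraNneq sj' => ->.
- by apply/activeP => // i Ai; rewrite expRK [line j' t]e; apply: ht.
- by apply/activeP => // i Ai; rewrite expRK; apply: ht.
Qed.

Lemma critical_below k r0 r1 : 0 < r1 -> r1 < r0 -> active l k r0 -> ~~ active l k r1 ->
  exists2 r, r1 < r <= r0 & critical l r.
Proof.
move=> p1 r10 a0 /forallPn[j]; rewrite -ltNge => h.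
have p0 := lt_trans p1 r10; have Ak := active_neq0 p0 a0.
have Aj : A j.
  have : 0 < term l j r1.
    by apply: le_lt_trans h; rewrite mulr_ge0 ?modulus_ge0 // exprn_ge0 // ltW.
  by rewrite pmulr_lgt0 // exprn_gt0.
have ln10 : - ln r0 < - ln r1 by rewrite ltrN2 ltr_ln ?posrE.
move: h; rewrite !term_line // ltr_expR => h.
have hk i : A i -> ln (modulus (tnth l i)) + (- i%:R) * - ln r0 <=
    ln (modulus (tnth l k)) + (- k%:R) * - ln r0.
  by rewrite !mulrNN; apply: (activeP p0 Ak a0).
have [|t /andP[t0 t1] [j' [Aj' sj' e ht]]] := @envelope_leaves R _ A
  (fun i => ln (modulus (tnth l i))) (fun i => - i%:R) k j _ _ ln10 hk Aj.
  by rewrite !mulrNN.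
exists (expR (- t)).
  rewrite -[r0]lnK ?posrE // -[r1]lnK ?posrE // ler_expR ltr_expR.
  by apply/andP; split; lra.
have r0' := expR_gt0 (- t).
have lineN i : ln (modulus (tnth l i)) + - i%:R * t = line i (- t) by rewrite /line mulrN mulNr.
apply: (@pair_critical j' k) => //.
- by apply: contraNneq sj' => ->.
- by apply/activeP => // i Ai; rewrite expRK -!lineN e; apply: ht.
- by apply/activeP => // i Ai; rewrite expRK -!lineN; apply: ht.
Qed.

Lemma newton_fun_max k t : A k -> (forall i, A i -> line i t <= line k t) ->
  newton_fun l t = (line k t)%:E.
Proof.
move=> Ak h; rewrite /newton_fun.
have val i : A i -> (lne (modulus (tnth l i))%:E + (i%:R * t)%:E)%E = (line i t)%:E.
  by move=> Ai; rewrite lne_EFin.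
apply/eqP; rewrite eq_le; apply/andP; split.
  apply/bigmax_leP; split; first by rewrite leNye.
  move=> i _; have [i0|Ai] := leP (modulus (tnth l i)) 0.
    by rewrite le0_lneNy ?lee_fin // addNye leNye.
  by rewrite val // lee_fin h.
by rewrite -val //; apply: le_bigmax.
Qed.

(* To the left of a critical point the lowest active index wins, to its right
   the highest one. *)
Lemma critical_vertex r : 0 < r -> critical l r -> vertex (newton_fun l) (ln r).
Proof.
move=> r0 /existsP[j /existsP[k /and3P[jk aj ak]]]; pose t := ln r.
pose lo := [arg min_(i < j | active l i r) val i]%N.
pose hi := [arg max_(i > k | active l i r) val i]%N.
have [alo minlo] : active l lo r /\ forall i, active l i r -> (lo <= i)%N.
  by rewrite /lo; case: arg_minnP.
have [ahi maxhi] : active l hi r /\ forall i, active l i r -> (i <= hi)%N.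
  by rewrite /hi; case: arg_maxnP.
have Alo := active_neq0 r0 alo; have Ahi := active_neq0 r0 ahi.
have ge i : A i -> line i t <= line lo t by move=> Ai; apply: (activeP r0 Alo alo).
have ehi : line hi t = line lo t.
  by apply/le_anti/andP; split; [exact: ge | exact: (activeP r0 Ahi ahi)].
have act i : A i -> line i t = line lo t -> active l i r.
  by move=> Ai e; apply/(activeP r0 Ai) => i' Ai'; rewrite -/t e; apply: ge.
(* All slopes lie between 0 and n, so a line lying [gap i * n.+1] below the maximum at t cannot
   reach it within time [gap i]. *)
pose gap i := (line lo t - line i t) / n.+1%:R.
have gap_gt0 i : A i -> ~~ active l i r -> 0 < gap i.
  move=> Ai ni; rewrite divr_gt0 ?ltr0n // subr_gt0 lt_neqAle ge // andbT.
  by apply: contraNneq ni; apply: act.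
have gapE i : line lo t - line i t = gap i * n.+1%:R by rewrite divfK ?pnatr_eq0.
have lin i s : line i s = line i t + i%:R * (s - t) by rewrite /line; ring.
exists (line lo t), lo%:R, hi%:R; split.
- rewrite eqr_nat ltn_eqF //; apply: leq_trans (maxhi _ ak); apply: leq_ltn_trans jk.
  exact: minlo.
- have H : \forall s \near t^'-, forall i, A i -> line i s <= line lo s.
    apply: filter_forall => i; have [ai|ni] := boolP (active l i r).
      near=> s => Ai; rewrite !(lin _ s).
      have st : s < t by near: s; exact: nbhs_left_lt.
      have h : lo%:R <= i%:R :> R by rewrite ler_nat minlo.
      have := ge i Ai; nra.
    have [i0|Ai] := leP (modulus (tnth l i)) 0; first by near=> s; rewrite /A ltNge i0.
    have g0 := gap_gt0 i Ai ni.
    near=> s => _; rewrite !(lin _ s).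
    have st : s < t by near: s; exact: nbhs_left_lt.
    have sg : t - gap i < s by near: s; apply: nbhs_left_gt; lra.
    have h1 : lo%:R <= n.+1%:R :> R by rewrite ler_nat ltnW.
    have h2 : 0 <= i%:R :> R by [].
    have := gapE i; have h3 : 0 <= lo%:R :> R by [].
    move: h1; move: (n.+1%:R) => N h1 e; nra.
  near=> s; rewrite (newton_fun_max Alo); last by near: s.
  by rewrite (lin lo s).
- have H : \forall s \near t^'+, forall i, A i -> line i s <= line hi s.
    apply: filter_forall => i; have [ai|ni] := boolP (active l i r).
      near=> s => Ai; rewrite !(lin _ s) ehi.
      have st : t < s by near: s; exact: nbhs_right_gt.
      have h : i%:R <= hi%:R :> R by rewrite ler_nat maxhi.
      have := ge i Ai; nra.
    have [i0|Ai] := leP (modulus (tnth l i)) 0; first by near=> s; rewrite /A ltNge i0.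
    have g0 := gap_gt0 i Ai ni.
    near=> s => _; rewrite !(lin _ s) ehi.
    have st : t < s by near: s; exact: nbhs_right_gt.
    have sg : s < t + gap i by near: s; apply: nbhs_right_lt; lra.
    have h1 : i%:R <= n.+1%:R :> R by rewrite ler_nat ltnW.
    have h2 : 0 <= i%:R :> R by [].
    have := gapE i; have h3 : 0 <= hi%:R :> R by [].
    move: h1; move: (n.+1%:R) => N h1 e; nra.
  near=> s; rewrite (newton_fun_max Ahi); last by near: s.
  by rewrite (lin hi s) ehi.
Unshelve. all: by end_near. Qed.

Lemma size_le_nb_vertices (rs : seq R) : uniq rs ->
  {in rs, forall r, 0 < r /\ critical l r} ->
  ((size rs)%:R%:E <= nb_vertices l)%E.
Proof.
move=> urs hrs; rewrite /nb_vertices /counting; case: ifPn => [/asboolP fin|_]; last exact: leey.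
rewrite lee_fin ler_nat -(size_map (@ln R)).
apply: uniq_leq_size.
  rewrite map_inj_in_uniq // => r r' /hrs[r0 _] /hrs[r0' _].
  by apply: ln_inj; rewrite posrE.
move=> _ /mapP[r /hrs[r0 cr] ->].
have : ln r \in [set t | vertex (newton_fun l) t] by apply/mem_set; apply: critical_vertex.
by rewrite -(in_fset_set fin).
Qed.

(* If r is 4-far from every critical point, one monomial dominates the sum of the others. *)
Lemma zero_near_critical z : root (poly_of_coefs l) z ->
  exists r, [/\ critical l r, modulus z <= 4 * r & r <= 4 * modulus z].
Proof.
rewrite /root /poly_of_coefs horner_sum => /eqP rz.
have pz : 0 < modulus z.
  rewrite modulus_gt0; apply/eqP => z0; move: rz; rewrite z0 big_ord_recl /=.
  rewrite hornerZ hornerXn expr0 mulr1 big1 ?addr0; last first.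
    by move=> i _; rewrite hornerZ hornerXn expr0n /= mulr0.
  by move/eqP; apply/negP.
pose r := modulus z; have [k ak] := exists_active r.
apply: contrapT => none.
have a4 : active l k (4 * r).
  apply: contraT => na; have [||t /andP[t0 t1] ct] := critical_above _ _ ak na => //; first by rewrite /r; lra.
  by case: none; exists t; split => //; rewrite /r in t0 t1 *; lra.
have b4 : active l k (r / 4).
  apply: contraT => na; have [||t /andP[t0 t1] ct] := critical_below _ _ ak na; rewrite /r; [lra|lra|].
  by case: none; exists t; split => //; rewrite /r in t0 t1 *; lra.
have Ak := active_neq0 pz ak.
pose T := term l k r; have T0 : 0 < T by rewrite mulr_gt0 // exprn_gt0.
have small (i : 'I_n.+1) : term l i r <= T * 4^-1 ^+ (if (i <= k)%N then k - i else i - k)%N.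
  case: ifPn => ik.
    have /forallP/(_ i) := b4; rewrite /term /T /term !exprMn => h.
    have p4 : 0 < 4^-1 ^+ i :> R by rewrite exprn_gt0.
    have e : 4^-1 ^+ k = 4^-1 ^+ (k - i) * 4^-1 ^+ i :> R by rewrite -exprD subnK.
    by rewrite -(ler_pM2r p4) -!mulrA -e.
  have /forallP/(_ i) := a4; rewrite /term /T /term !exprMn => h.
  have ki : (k <= i)%N by rewrite ltnW // ltnNge.
  have p4 : 0 < 4 ^+ i :> R by rewrite exprn_gt0.
  have e : 4 ^+ k = 4^-1 ^+ (i - k) * 4 ^+ i :> R.
    by rewrite -{2}(subnK ki) exprD mulrA -exprMn mulVf ?expr1n ?mul1r.
  rewrite -(ler_pM2r p4) -!mulrA -e.
  by rewrite [r ^+ i * _]mulrC [r ^+ k * _]mulrC.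
have : T <= \sum_(i < n.+1 | i != k) term l i r.
  have : tnth l k * z ^+ k = - \sum_(i < n.+1 | i != k) tnth l i * z ^+ i.
    apply/eqP; rewrite -subr_eq0 opprK -[X in _ == X]rz [X in _ == X](bigD1 k) //=.
    rewrite hornerZ hornerXn; apply/eqP; congr (_ + _); apply: eq_bigr => i _.
    by rewrite hornerZ hornerXn.
  move/(congr1 (@modulus R)); rewrite modulusM modulusX modulusN => e.
  rewrite /T /term /r e; apply: le_trans (le_modulus_sum _ _ _) _.
  by apply: ler_sum => i _; rewrite modulusM modulusX.
apply/negP; rewrite -ltNge.
pose d i := (if (i <= k)%N then k - i else i - k)%N.
(* On each side of k a geometric series of ratio 1/4, with sum at most 1/3; the total stays below
   1. *)
pose u i : R := if i == k :> nat then 0 else 4^-1 ^+ d i.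
have low J : (J <= k)%N -> \sum_(i < J) u i <= 3^-1 * 4^-1 ^+ (k - J).
  elim: J => [_|J IH Jk]; first by rewrite big_ord0 mulr_ge0 // exprn_ge0.
  rewrite big_ord_recr /=; have := IH (ltnW Jk).
  rewrite /u ltn_eqF // /d (ltnW Jk) -(subnSK Jk) exprS.
  by move: (4^-1 ^+ _) => v; lra.
have high J : (k <= J)%N -> \sum_(i < J.+1) u i <= 3^-1 + 3^-1 * (1 - 4^-1 ^+ (J - k)).
  elim: J => [|J IH]; last rewrite leq_eqVlt => /predU1P[kJ|kJ].
  - rewrite leqn0 => /eqP k0; rewrite big_ord1 /u k0 eqxx subnn expr0; lra.
  - rewrite big_ord_recr /= [u J.+1]/u kJ eqxx addr0 subnn expr0 subrr mulr0 addr0.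
    have h : (J.+1 <= k)%N by rewrite kJ.
    by have := low _ h; rewrite kJ subnn expr0 mulr1.
  rewrite big_ord_recr /= [u J.+1]/u gtn_eqF // /d leqNgt kJ /= subSn // exprS.
  by have := IH kJ; move: (4^-1 ^+ _) => v; lra.
have usum : \sum_(i < n.+1) u i < 1.
  have := high n; rewrite -ltnS ltn_ord => /(_ isT).
  have : 0 < 4^-1 ^+ (n - k) :> R by rewrite exprn_gt0.
  by lra.
apply: (@le_lt_trans _ _ (\sum_(i < n.+1) T * u i)); last first.
  by rewrite -mulr_sumr -[ltRHS]mulr1 ltr_pM2l.
rewrite big_mkcond /=; apply: ler_sum => i _; case: eqP => [->|/eqP ik] /=.
  by rewrite /u eqxx mulr0.
by rewrite /u -[_ == _]/(i == k) (negbTE ik); apply: small.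
Qed.

End newton_polygon.

(** * Closeness of points on a logarithmically Lipschitz curve *)

Section polar_distance.
Variable R : realType.

Lemma sin_lipschitz (a b : R) : `|sin a - sin b| <= `|a - b|.
Proof.
wlog ab : a b / b <= a.
  by move=> H; have [/H//|/ltW /H h] := leP b a; rewrite distrC [leRHS]distrC.
have [|c _ ->] := @MVT_segment R sin cos _ _ ab (fun x _ => is_derive_sin x).
  by apply: continuous_subspaceT => x; apply: continuous_sin.
by rewrite normrM ler_piMl // ler_norml cos_geN1 cos_le1.
Qed.

Lemma cos_lipschitz (a b : R) : `|cos a - cos b| <= `|a - b|.
Proof.
wlog ab : a b / b <= a.
  by move=> H; have [/H//|/ltW /H h] := leP b a; rewrite distrC [leRHS]distrC.
have [|c _ ->] := @MVT_segment R cos (fun x => - sin x) _ _ ab (fun x _ => is_derive_cos x).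
  by apply: continuous_subspaceT => x; apply: continuous_cos.
by rewrite normrM normrN ler_piMl // ler_norml sin_geN1 sin_le1.
Qed.

Definition polar (theta : R -> R) (r : R) : R[i] :=
  ((r * cos (theta r)) +i* (r * sin (theta r)))%C.

Lemma modulus_polar theta r : 0 <= r -> modulus (polar theta r) = r.
Proof.
move=> r0; rewrite /modulus normc_def /= !exprMn -mulrDr cos2Dsin2 mulr1.
by rewrite sqrtr_sqr ger0_norm.
Qed.

Lemma ln_ratio (r r1 eps : R) : 0 < r -> 0 < r1 -> eps <= 2^-1 ->
  `|r - r1| <= eps * r1 -> `|ln (r / r1)| <= 2 * eps.
Proof.
move=> r0 p1 e2; rewrite ler_distl => /andP[lo hi].
have eps0 : 0 <= eps by rewrite -(pmulr_lge0 _ p1); lra.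
have d0 : 0 < r / r1 by rewrite divr_gt0.
rewrite ler_norml; apply/andP; split.
  rewrite -(invrK (r / r1)) lnV ?posrE ?invr_gt0 // lerN2 invf_div.
  have -> : r1 / r = 1 + (r1 - r) / r by field; rewrite gt_eqF.
  apply: le_trans (le_ln1Dx _) _.
    have -> : (r1 - r) / r = r1 / r - 1 by field; rewrite gt_eqF.
    have : 0 < r1 / r by rewrite divr_gt0.
    lra.
  rewrite ler_pdivrMr //; nra.
have -> : r / r1 = 1 + (r - r1) / r1 by field; rewrite gt_eqF.
apply: le_trans (le_ln1Dx _) _.
  have -> : (r - r1) / r1 = r / r1 - 1 by field; rewrite gt_eqF.
  lra.
rewrite ler_pdivrMr //; nra.
Qed.

(** A relative change eps of the radius turns the angle by at most 2 L eps, so each coordinate moves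
    by at most (1 + 2 L) eps r1; the two are added. *)
Lemma polar_close theta (L r r1 eps : R) : 0 <= L -> log_lipschitz L theta ->
  0 < r -> 0 < r1 -> eps <= 2^-1 -> `|r - r1| <= eps * r1 ->
  modulus (polar theta r - polar theta r1) <= (2 + 4 * L) * eps * r1.
Proof.
move=> L0 lip r0 p1 e2 rr.
have th : `|theta r - theta r1| <= 2 * L * eps.
  apply: le_trans (lip _ _ r0 p1) _; rewrite [2 * L]mulrC -mulrA.
  by rewrite ler_wpM2l // ln_ratio.
have trig (f : R -> R) : (forall a, `|f a| <= 1) -> (forall a b, `|f a - f b| <= `|a - b|) ->
    `|r * f (theta r) - r1 * f (theta r1)| <= (1 + 2 * L) * eps * r1.
  move=> f1 flip.
  have -> : r * f (theta r) - r1 * f (theta r1) =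
    (r - r1) * f (theta r) + r1 * (f (theta r) - f (theta r1)) by ring.
  apply: le_trans (ler_normD _ _) _; rewrite !normrM (gtr0_norm p1).
  have h1 : `|r - r1| * `|f (theta r)| <= eps * r1.
    by apply: le_trans rr; rewrite ler_piMr.
  have h2 : r1 * `|f (theta r) - f (theta r1)| <= r1 * (2 * L * eps).
    by rewrite (ler_wpM2l (ltW p1)) // (le_trans (flip _ _)).
  by lra.
apply: le_trans (modulus_ReIm _ _) _.
have c := trig cos (fun a => _) cos_lipschitz; have s := trig sin (fun a => _) sin_lipschitz.
have -> : (2 + 4 * L) * eps * r1 = (1 + 2 * L) * eps * r1 + (1 + 2 * L) * eps * r1 by ring.
apply: lerD; [apply: c | apply: s] => a; rewrite ler_norml.
  by rewrite cos_geN1 cos_le1.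
by rewrite sin_geN1 sin_le1.
Qed.

End polar_distance.

(** * Zeros in a single cell *)

Section root_count_in_cell.
Variables (R : realType).

Lemma bernoulli_upper (x : R) k : 0 <= x -> k%:R * x <= 2^-1 ->
  (1 + x) ^+ k <= 1 + 2 * (k%:R * x).
Proof.
move=> x0; elim: k => [|k IH] kx; first by rewrite expr0; lra.
have k0 : 0 <= k%:R * x by rewrite mulr_ge0.
move: kx; rewrite -natr1 mulrDl mul1r => kx.
have := IH _; rewrite exprS; move: (k%:R * x) k0 kx => y y0 yx h.
have /h {}h : y <= 2^-1 by lra.
have : (1 + x) * (1 + x) ^+ k <= (1 + x) * (1 + 2 * y) by rewrite ler_wpM2l //; lra.
by move/le_trans; apply; nra.
Qed.

Lemma poly_of_coefsE n (l : n.+1.-tuple R[i]) : poly_of_coefs l = \poly_(k < n.+1) l`_k.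
Proof.
by rewrite /poly_of_coefs poly_def; apply: eq_bigr => k _; rewrite (tnth_nth 0).
Qed.

Lemma coef_poly_of_coefs n (l : n.+1.-tuple R[i]) (k : 'I_n.+1) :
  (poly_of_coefs l)`_k = tnth l k.
Proof. by rewrite poly_of_coefsE coef_poly ltn_ord (tnth_nth 0). Qed.

Lemma horner_poly_of_coefs n (l : n.+1.-tuple R[i]) w :
  (poly_of_coefs l).[w] = value (tnth l) w.
Proof.
rewrite /poly_of_coefs horner_sum; apply: eq_bigr => k _.
by rewrite hornerZ hornerXn.
Qed.

(** Small enough that 2 m samples drift by a relative amount of order 1 / (h n), so that powers up
    to n + 2 change by at most a factor 2. *)
Definition step (h m n : nat) : R := (4 * m * h * n.+1)%:R^-1.

(** A mesh of the square [-4, 4]^2; the half-side is the factor 4 of [zero_near_critical]. *)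
Definition grid_point (h n a b : nat) : R[i] :=
  ((a%:R / (4 * h * n)%:R - 4) +i* (b%:R / (4 * h * n)%:R - 4))%C.

(* The good event: all crossings of two monomials, not only the vertices of the
   Newton polygon, are required to have large samples nearby, so that each
   condition involves the two coefficients j and k only through the scale. *)
Definition well_spread (h m n : nat) (l : n.+1.-tuple R[i]) : Prop :=
  forall (j k : 'I_n.+1) (a b : 'I_(8 * (4 * h * n)).+1),
    grid_point h n a b != 0 ->
    ~~ poorly_spread m (step h m n) (tnth l) ((crossing l j k)%:C%C * grid_point h n a b).

Lemma grid_dense (h n : nat) (x : R) : (0 < h)%N -> (0 < n)%N -> `|x| <= 4 ->
  exists a : 'I_(8 * (4 * h * n)).+1, `|x - (a%:R / (4 * h * n)%:R - 4)| <= (4 * h * n)%:R^-1.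
Proof.
move=> h0 n0; rewrite ler_norml => /andP[x1 x2].
set g := (4 * h * n)%N; have g0 : 0 < g%:R :> R by rewrite ltr0n !muln_gt0 h0 n0.
have y0 : 0 <= (x + 4) * g%:R by rewrite mulr_ge0 //; lra.
have /andP[lo hi] := truncn_itv y0.
have ag : (Num.truncn ((x + 4) * g%:R) < (8 * g).+1)%N.
  rewrite ltnS -(ler_nat R) natrM; apply: le_trans lo _.
  by rewrite ler_wpM2r ?ler0n //; lra.
exists (Ordinal ag) => /=; move: lo hi; move: (Num.truncn _) => a lo hi.
have gi : g%:R^-1 * g%:R = 1 :> R by rewrite mulVf // gt_eqF.
have gi0 : 0 < g%:R^-1 :> R by rewrite invr_gt0.
have e : x - (a%:R / g%:R - 4) = ((x + 4) * g%:R - a%:R) * g%:R^-1.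
  by field; rewrite gt_eqF.
rewrite e normrM (gtr0_norm gi0) ler_piMl ?(ltW gi0) // ler_norml.
by move: hi; rewrite -natr1 => hi; apply/andP; split; lra.
Qed.

Variables (h m n : nat) (l : n.+1.-tuple R[i]).
Hypotheses (h_big : 224 <= h%:R :> R) (m_gt0 : (0 < m)%N) (n_gt0 : (0 < n)%N)
  (l0 : tnth l ord0 != 0) (l_spread : well_spread h m l).

Let al := step h m n.

Let h_gt0 : (0 < h)%N.
Proof. by rewrite -(ltr0n R); apply: lt_le_trans h_big; rewrite ltr0n. Qed.

Lemma step_gt0 : 0 < al.
Proof. by rewrite invr_gt0 ltr0n !muln_gt0 m_gt0 h_gt0. Qed.

Let stepE : al * (m%:R * h%:R * n.+1%:R) = 4^-1.
Proof.
have m0 : m%:R != 0 :> R by rewrite pnatr_eq0 -lt0n.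
have h0 : h%:R != 0 :> R by rewrite pnatr_eq0 -lt0n.
have n0 : n.+1%:R != 0 :> R by rewrite pnatr_eq0.
by rewrite /al /step !natrM; field; rewrite m0 h0 -[1 + n%:R](_ : n.+1%:R = _) ?n0 // -add1n natrD.
Qed.

Lemma step_small : al * (2 * m * n.+2)%:R <= 2^-1 * 2^-1.
Proof.
have al0 := step_gt0.
have m0 : 0 < m%:R :> R by rewrite ltr0n.
have e := stepE; have hb := h_big.
rewrite !natrM -[n.+2%:R]natr1; have : 0 < n.+1%:R :> R by [].
have : 1 <= n.+1%:R :> R by rewrite ler1n.
move: (n.+1%:R) e => N e N1 N0.
have h1 : al * m%:R * N * 224 <= 4^-1.
  have p := ltW (mulr_gt0 (mulr_gt0 al0 m0) N0).
  by have := ler_wpM2l p hb; rewrite -e; lra.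
have h2 : al * m%:R <= al * m%:R * N by rewrite (ler_peMr (ltW (mulr_gt0 al0 m0))).
by lra.
Qed.

Lemma step_le1 : al <= 1.
Proof.
have := step_small; have al0 := step_gt0.
have : al <= al * (2 * m * n.+2)%:R.
  by rewrite ler_peMr ?(ltW al0) // ler1n !muln_gt0 m_gt0.
lra.
Qed.

Lemma step_pow : (1 + al) ^+ (2 * m * n.+2) <= 2.
Proof.
have s := step_small; apply: le_trans (bernoulli_upper (ltW step_gt0) _) _.
  by rewrite mulrC; lra.
by rewrite mulrC [_ * al]mulrC; lra.
Qed.

(** [z0] is r times a grid point near z1 / r, and [w] a sample of the progression from [z0]. Each
    coordinate of z0 - z1 is at most r / (4 h n) <= r1 / (h n) <= e / 2, where 224 = 2 * 112 is
    used; the samples drift by at most 8 m al r1 = 2 r1 / (h (n + 1)) <= e. *)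
Lemma exists_large_sample (r r1 e : R) (z1 : R[i]) :
  critical l r -> 0 < r -> r1 = modulus z1 -> 0 < r1 -> r1 <= 4 * r -> r <= 4 * r1 ->
  r1 / (112 * n%:R) <= e -> e <= r1 / 14 ->
  exists (z0 : R[i]), [/\ modulus (z0 - z1) <= e & forall k : 'I_n.+1, exists (w : R[i]),
   [/\ modulus (w - z0) <= e, modulus w ^+ k <= 2 * modulus z0 ^+ k &
     threshold n m al * term l k (modulus z0) <= modulus (poly_of_coefs l).[w] ]].
Proof.
move=> cr r0 r1E r10 r1r rr1 e1 e2.
have n0 : 0 < n%:R :> R by rewrite ltr0n.
have hb := h_big.
have [j [j' rE]] := critical_crossing l0 r0 cr.
have bound (x : R) : `|x| <= r1 -> `|x / r| <= 4.
  by move=> x1; rewrite normrM normfV (gtr0_norm r0) ler_pdivrMr // (le_trans x1).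
have hR : 0 < h%:R :> R by rewrite ltr0n h_gt0.
have [|a ha] := grid_dense h_gt0 n_gt0 (bound (complex.Re z1) _).
  by rewrite r1E Re_le_modulus.
have [|b hb'] := grid_dense h_gt0 n_gt0 (bound (complex.Im z1) _).
  by rewrite r1E Im_le_modulus.
pose u := grid_point h n a b; pose z0 := r%:C%C * u; exists z0.
have gE : (4 * h * n)%:R^-1 * (4 * h%:R * n%:R) = 1 :> R.
  by rewrite !natrM mulVf // gt_eqF // !mulr_gt0.
have near (x v : R) : `|x / r - v| <= (4 * h * n)%:R^-1 -> `|r * v - x| <= e / 2.
  move=> xv; have -> : r * v - x = - (r * (x / r - v)) by field; rewrite gt_eqF.
  rewrite normrN normrM (gtr0_norm r0).
  apply: le_trans (ler_wpM2l (ltW r0) xv) _.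
  rewrite ler_pdivlMr //; apply: le_trans e1; rewrite ler_pdivlMr ?mulr_gt0 //.
  have g0 : 0 < (4 * h * n)%:R^-1 :> R by rewrite invr_gt0 ltr0n !muln_gt0 h_gt0 n_gt0.
  move: ((4 * h * n)%:R^-1) gE g0 => g gE g0.
  have p : 0 <= r * g * n%:R by rewrite !mulr_ge0 ?ler0n ?(ltW r0) ?(ltW g0).
  have := ler_wpM2l p hb.
  have -> : r * g * n%:R * h%:R = r / 4 * (g * (4 * h%:R * n%:R)) by field.
  by rewrite gE; lra.
have dz0 : modulus (z0 - z1) <= e.
  have -> : z0 - z1 = ((r * (a%:R / (4 * h * n)%:R - 4) - complex.Re z1) +i*
                       (r * (b%:R / (4 * h * n)%:R - 4) - complex.Im z1))%C.
    by rewrite /z0 /u /grid_point; case: (z1) => x y; simpc.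
  apply: le_trans (modulus_ReIm _ _) _.
  by have := near _ _ ha; have := near _ _ hb'; lra.
have u0 : u != 0.
  apply/eqP => u0; move: dz0; rewrite /z0 u0 mulr0 sub0r modulusN -r1E; lra.
split=> // k; have := l_spread j j' u0; rewrite -rE -/z0 => nps.
have := fintype.existsPn nps k; move=> /forallPn[ i].
rewrite -leNgt => hi; exists (sample al z0 i).
have im := ltn_ord i; have kn : (k <= n.+2)%N by rewrite ltnW // ltnW // ltnS.
have [z0lo z0hi] : modulus z0 <= 2 * r1 /\ 0 <= modulus z0.
  split; last exact: modulus_ge0.
  have := modulus_triangle z0 z1 0; rewrite !subr0 -r1E => h1; lra.
split.
- have -> : sample al z0 i - z0 = z0 * ((1 + al) ^+ i - 1)%:C%C.
    by rewrite /sample rmorphB /= mulrBr mulr1.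
  have al0 := step_gt0.
  have q1 : 1 <= (1 + al) ^+ i by rewrite exprn_ege1 // lerDl ltW.
  rewrite modulusM modulus_real ger0_norm ?subr_ge0 //.
  have im2 : al * (2 * m)%:R * n.+1%:R * h%:R = 2^-1.
    by have := stepE; rewrite natrM => e'; lra.
  have ial : i%:R * al <= al * (2 * m)%:R.
    by rewrite mulrC (ler_wpM2l (ltW al0)) // ler_nat ltnW.
  have n1 : n%:R <= n.+1%:R :> R by rewrite ler_nat.
  have N0 : 0 < n.+1%:R :> R by [].
  have A0 : 0 <= al * (2 * m)%:R by rewrite mulr_ge0 ?(ltW al0).
  have h1 : al * (2 * m)%:R * n%:R * 224 <= 2^-1.
    rewrite -im2; apply: ler_pM => //; first by rewrite mulr_ge0.
    by rewrite ler_wpM2l.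
  have n11 : 1 <= n%:R :> R by rewrite ler1n.
  have h2 : al * (2 * m)%:R * 224 <= 2^-1.
    by apply: le_trans h1; rewrite ler_wpM2r // ler_peMr.
  have q2 : (1 + al) ^+ i - 1 <= 2 * (al * (2 * m)%:R).
    have := bernoulli_upper (ltW al0) (k := i); move: h2 ial; move: (i%:R * al) (al * _) => u1 u2 h2 ial.
    by move=> /(_ _); lra.
  apply: le_trans e1; rewrite ler_pdivlMr ?mulr_gt0 //.
  have p1 : modulus z0 * ((1 + al) ^+ i - 1) <= 2 * r1 * (2 * (al * (2 * m)%:R)).
    by apply: ler_pM => //; rewrite subr_ge0.
  have p2 : 0 <= 112 * n%:R :> R by rewrite mulr_ge0.
  apply: le_trans (ler_wpM2r p2 p1) _.
  have := ler_wpM2l (ltW r10) h1; lra.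
- by rewrite -modulusX -modulusX; have /andP[_] := modulus_sampleX step_gt0 step_pow z0 im kn; rewrite !modulusX.
- by rewrite horner_poly_of_coefs.
Qed.

(** Up to a factor 1 + 1 / (2 n) in the radius, whose powers up to n are at most 2, the annulus r1 -
    7 e, r1 + 7 e lies between r1 / delta and r1 delta, where monomial k dominates. Here 112 = 7 *
    16, and delta <= 4 gives 1 / delta <= 1 - (delta - 1) / 16. *)
Lemma wnorm_active_le (k : 'I_n.+1) (r1 delta e : R) : 0 < r1 -> 1 <= delta -> delta <= 4 ->
  e = r1 * (delta - 1 + n%:R^-1) / 112 ->
  active l k (r1 * delta) -> active l k (r1 / delta) ->
  wnorm (r1 + 7 * e) (r1 - 7 * e) k n.+1 (poly_of_coefs l) <= n.+1%:R * (2 * modulus (tnth l k)).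
Proof.
move=> r10 d1 d4 eE /forallP up /forallP down.
have n0 : 0 < n%:R :> R by rewrite ltr0n.
have v0 : 0 < n%:R^-1 :> R by rewrite invr_gt0.
have v1 : n%:R^-1 <= 1 :> R by rewrite invf_le1 // ler1n.
have nv : n%:R * n%:R^-1 = 1 :> R by rewrite mulfV // gt_eqF.
have pow2 i : (i <= n)%N -> (1 + n%:R^-1 / 2) ^+ i <= 2 :> R.
  move=> iN; have h2 : i%:R * (n%:R^-1 / 2) <= 2^-1 :> R.
    by rewrite mulrA ler_pdivrMr // mulVf // ler_pdivrMr // mul1r ler_nat.
  apply: le_trans (bernoulli_upper _ h2) _; [lra|lra].
set v := n%:R^-1 in eE v0 v1 pow2; move: v v0 v1 eE pow2 => v v0 v1 eE pow2 {nv}.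
have d0 : 0 < delta by lra.
set Rp := r1 + _; set Rm := r1 - _.
have RpE : Rp <= r1 * delta * (1 + v / 2).
  have : 0 <= r1 * (delta * v) by rewrite !mulr_ge0 // ltW.
  have : 0 <= r1 * (delta - 1) by rewrite mulr_ge0 ?(ltW r10) //; lra.
  have : r1 * v <= r1 * (delta * v) by rewrite ler_pM2l // ler_peMl // ltW.
  by rewrite /Rp eE; lra.
have RmE : r1 / delta <= Rm * (1 + v / 2).
  pose d' := delta^-1; have dd : delta * d' = 1 by rewrite mulfV // gt_eqF.
  have d'4 : 4^-1 <= d' by rewrite lef_pV2 ?posrE.
  have X : d' <= 1 - (delta - 1) / 16.
    have : 0 <= (delta - 1) * (d' - 16^-1) by rewrite mulr_ge0 //; lra.
    lra.
  have Y : d' <= (1 - (delta - 1) / 16 - v / 16) * (1 + v / 2) by nra.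
  have -> : Rm * (1 + v / 2) = r1 * ((1 - (delta - 1) / 16 - v / 16) * (1 + v / 2)).
    by rewrite /Rm eE; field.
  by rewrite ler_pM2l.
have Rp0 : 0 <= Rp by rewrite addr_ge0 ?(ltW r10) // mulr_ge0 // eE divr_ge0 // mulr_ge0 ?(ltW r10) //; lra.
have Rm0 : 0 < Rm.
  by rewrite -(pmulr_lgt0 _ (_ : 0 < 1 + v / 2)); [apply: lt_le_trans RmE; rewrite divr_gt0 | lra].
have coef (j : 'I_n.+1) : modulus (tnth l j) * weight Rp Rm k j <= 2 * modulus (tnth l k).
  have cj0 := modulus_ge0 (tnth l j); have ck0 := modulus_ge0 (tnth l k).
  have jn : (j <= n)%N by rewrite -ltnS.
  have kn : (k <= n)%N by rewrite -ltnS.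
  rewrite /weight; case: leqP => kj.
    have x0 : 0 < r1 * delta by rewrite mulr_gt0.
    have h1 : Rp ^+ (j - k) <= (r1 * delta) ^+ (j - k) * 2.
      apply: (@le_trans _ _ ((r1 * delta * (1 + v / 2)) ^+ (j - k))).
        by rewrite lerXn2r ?nnegrE // (le_trans Rp0).
      rewrite exprMn ler_wpM2l ?exprn_ge0 ?(ltW x0) // pow2 //.
      exact: leq_trans (leq_subr _ _) jn.
    have h2 : modulus (tnth l j) * (r1 * delta) ^+ (j - k) <= modulus (tnth l k).
      rewrite -(ler_pM2r (exprn_gt0 k x0)) -mulrA -exprD subnK //; exact: up.
    apply: le_trans (ler_wpM2l cj0 h1) _; rewrite mulrA mulrC.
    by rewrite ler_wpM2l.
  have x0 : 0 < r1 / delta by rewrite divr_gt0.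
  have h1 : Rm^-1 ^+ (k - j) <= (r1 / delta)^-1 ^+ (k - j) * 2.
    apply: (@le_trans _ _ (((r1 / delta)^-1 * (1 + v / 2)) ^+ (k - j))).
      rewrite lerXn2r ?nnegrE ?invr_ge0 ?(ltW Rm0) //.
        by rewrite mulr_ge0 ?invr_ge0 ?(ltW x0) //; lra.
      by rewrite ler_pdivlMl // ler_pdivrMr // [leRHS]mulrC.
    rewrite exprMn ler_wpM2l ?exprn_ge0 ?invr_ge0 ?(ltW x0) // pow2 //.
    exact: leq_trans (leq_subr _ _) kn.
  have h2 : modulus (tnth l j) * (r1 / delta)^-1 ^+ (k - j) <= modulus (tnth l k).
    rewrite exprVn ler_pdivrMr ?exprn_gt0 //.
    rewrite -(ler_pM2r (exprn_gt0 j x0)) -mulrA -exprD subnK ?(ltnW kj) //; exact: down.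
  apply: le_trans (ler_wpM2l cj0 h1) _; rewrite mulrA mulrC.
  by rewrite ler_wpM2l.
rewrite /wnorm; apply: (@le_trans _ _ (\sum_(j < n.+1) 2 * modulus (tnth l k))).
  by apply: ler_sum => j _; rewrite coef_poly_of_coefs.
by rewrite sumr_const card_ord -[leLHS]mulr_natl.
Qed.

(** The roots are within e of z1 and the large sample w within 2 e, so |w - zeta| <= 3 e: the margin
    s is 6 e and the annulus has half-width 7 e. With no critical radius strictly between r1 / delta
    and r1 delta, a monomial active at r1 is active at both ends. *)
Lemma root_count_near (r delta : R) (z1 : R[i]) (rs : seq R[i]) (Q : {poly R[i]}) :
  critical l r -> 0 < r -> z1 != 0 -> 1 <= delta -> delta <= 4 ->
  modulus z1 = r * delta \/ r = modulus z1 * delta ->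
  (forall t, critical l t -> modulus z1 / delta < t -> t < modulus z1 * delta -> False) ->
  (forall z, z \in rs ->
     modulus (z - z1) <= modulus z1 * (delta - 1 + n%:R^-1) / 112) ->
  poly_of_coefs l = \prod_(z <- rs) ('X - z%:P) * Q ->
  2 ^+ size rs * threshold n m al <= 4 * n.+1%:R.
Proof.
move=> cr r0 z1n d1 d4 r1r nocrit near PE; set r1 := modulus z1 in r1r nocrit near *.
have r10 : 0 < r1 by rewrite modulus_gt0.
have d0 : 0 < delta by lra.
have n0 : 0 < n%:R :> R by rewrite ltr0n.
have v0 : 0 < n%:R^-1 :> R by rewrite invr_gt0.
have v1 : n%:R^-1 <= 1 :> R by rewrite invf_le1 // ler1n.
set e := r1 * _ / 112 in near.
have [k ak] := exists_active l r1.
have up : active l k (r1 * delta).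
  have [d1'|d1'] := eqVneq delta 1; first by rewrite d1' mulr1.
  apply: contraT => na.
  have lt1 : r1 < r1 * delta by rewrite ltr_pMr // lt_neqAle eq_sym d1' d1.
  have [t /andP[t0 t1] ct] := critical_above l0 r10 lt1 ak na.
  case: (nocrit t ct _ t1); apply: lt_le_trans t0.
  by rewrite ltr_pdivrMr.
have down : active l k (r1 / delta).
  have [d1'|d1'] := eqVneq delta 1; first by rewrite d1' divr1.
  apply: contraT => na.
  have lt1 : r1 < r1 * delta by rewrite ltr_pMr // lt_neqAle eq_sym d1' d1.
  have lt2 : r1 / delta < r1 by rewrite ltr_pdivrMr.
  have [t /andP[t0 t1] ct] := critical_below l0 (divr_gt0 r10 d0) lt2 ak na.
  by case: (nocrit t ct t0); apply: le_lt_trans lt1.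
have W := wnorm_active_le r10 d1 d4 (erefl e) up down.
have e0 : r1 / (112 * n%:R) <= e.
  rewrite /e invfM mulrA mulrAC ler_wpM2r // ler_wpM2l ?(ltW r10) //; lra.
have e2 : e <= r1 / 14.
  have : r1 * (delta - 1 + n%:R^-1) <= r1 * 4 by rewrite ler_wpM2l ?(ltW r10) //; lra.
  by rewrite /e; lra.
have ep : 0 < e by apply: lt_le_trans e0; rewrite divr_gt0 // mulr_gt0.
have [r1r4 r4r1] : r1 <= 4 * r /\ r <= 4 * r1.
  by case: r1r => ->; split; nra.
have [z0 [z01 hz0]] := exists_large_sample cr r0 (erefl r1) r10 r1r4 r4r1 e0 e2.
have [w [wz0 wk big]] := hz0 k.
have wz1 : modulus (w - z1) <= 2 * e.
  by apply: le_trans (modulus_triangle _ z0 _) _; lra.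
have wlo : r1 - 2 * e <= modulus w.
  by have := modulus_triangle z1 w 0; rewrite !subr0 modulusB -/r1; lra.
have whi : modulus w <= r1 + 2 * e.
  by have := modulus_triangle w z1 0; rewrite !subr0 -/r1; lra.
have Q0 : Q != 0.
  apply/eqP => Q0; move: PE; rewrite Q0 mulr0 => /(congr1 (fun p : {poly R[i]} => p`_(@ord0 n))).
  by rewrite coef_poly_of_coefs coef0 => /eqP; apply/negP.
have PN : (size (poly_of_coefs l) <= n.+1)%N by rewrite poly_of_coefsE size_poly.
rewrite PE in PN.
have Rm0 : 0 < r1 - 7 * e by lra.
have RmRp : r1 - 7 * e <= r1 + 7 * e by lra.
have s0 : 0 < 6 * e by lra.
have wR : r1 - 7 * e <= modulus w <= r1 + 7 * e by apply/andP; split; lra.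
have := @root_count_bound _ _ _ k Rm0 RmRp (6 * e) n.+1 rs Q w s0 _ wR Q0 PN.
have hroots zeta : zeta \in rs -> [/\ modulus zeta + 6 * e <= r1 + 7 * e,
    r1 - 7 * e + 6 * e <= modulus zeta & modulus (w - zeta) <= 6 * e / 2].
  move=> /near hz.
  have t1 := modulus_triangle zeta z1 0; have t2 := modulus_triangle z1 zeta 0.
  have t3 := modulus_triangle w z1 zeta.
  rewrite !subr0 -/r1 in t1 t2; rewrite (modulusB z1) in t2 t3.
  by split; lra.
move=> /(_ hroots); rewrite -PE => main.
have ck := active_neq0 l0 r10 ak.
have z00 : 0 < modulus z0.
  have := modulus_triangle z1 z0 0; rewrite !subr0 -/r1 modulusB; lra.
have T0 : 0 < term l k (modulus z0) by rewrite mulr_gt0 // exprn_gt0.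
rewrite -(ler_pM2r T0) -mulrA.
apply: le_trans (ler_wpM2l _ big) _; first by rewrite exprn_ge0.
apply: le_trans main _.
apply: le_trans (ler_pM _ _ wk W) _; rewrite ?exprn_ge0 ?modulus_ge0 ?wnorm_ge0 //.
by rewrite /term le_eqVlt; apply/orP; left; apply/eqP; ring.
Qed.

End root_count_in_cell.

(** * Covering the zeros on a curve by cells *)

Lemma count_undup_sum (T : eqType) (s : seq T) (a : pred T) :
  count a s = (\sum_(x <- undup s | a x) count_mem x s)%N.
Proof.
have /permP/(_ a) <- := perm_count_undup s.
rewrite count_flatten sumnE !big_map [RHS]big_mkcond /=; apply: eq_bigr => x _.
by rewrite count_nseq; case: (a x); rewrite ?mul1n ?mul0n.
Qed.

Lemma size_le_sum_cells (T : Type) (K : finType) (rel : T -> K -> bool) (s : seq T) :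
  all (fun x => [exists k, rel x k]) s ->
  (size s <= \sum_k size [seq x <- s | rel x k])%N.
Proof.
elim: s => [//|x s IH] /= /andP[/existsP[k xk] /IH sz].
rewrite (bigD1 k) //= xk /= addSn ltnS; apply: leq_trans sz _.
rewrite [X in (X <= _)%N](bigD1 k) //= leq_add2l; apply: leq_sum => i _.
by case: ifP => //= _; apply: leqnSn.
Qed.

Lemma nb_zeros_roots (R : realType) (G : set R[i]) (a : R[i]) (rs : seq R[i]) : a != 0 ->
  nb_zeros G (a *: \prod_(z <- rs) ('X - z%:P)) = size [seq z <- rs | z \in G].
Proof.
move=> a0; have mupE z : mup z (a *: \prod_(z <- rs) ('X - z%:P)) = count_mem z rs.
  by rewrite -mul_polyC mupMr ?rootC // mu_prod_XsubC.
rewrite /nb_zeros size_filter count_undup_sum.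
transitivity (\sum_(z <- undup rs | z \in G) mup z (a *: \prod_(z <- rs) ('X - z%:P)))%N.
  rewrite [RHS]bigfs ?undup_uniq ?set_mem_set // => z _.
  by rewrite mem_undup mupE => /count_memPn.
by apply: eq_bigr => z _; apply: mupE.
Qed.

Section counting_cells.
Variables (R : realType) (h m n h' M N0 : nat) (l : n.+1.-tuple R[i]) (L : R).
Hypotheses (h_big : 224 <= h%:R :> R) (m_gt0 : (0 < m)%N) (n_gt0 : (0 < n)%N)
  (l0 : tnth l ord0 != 0) (l_spread : well_spread h m l)
  (L0 : 0 <= L) (h'_big : 112 * (2 + 4 * L) <= h'%:R)
  (M_big : 1 + 3 * n%:R < (1 + h'%:R^-1) ^+ M :> R)
  (N0_big : forall N, 2 ^+ N * threshold n m (step R h m n) <= 4 * n.+1%:R -> (N <= N0)%N).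

Let q : R := 1 + h'%:R^-1.

Definition critical_seq : seq R :=
  undup [seq crossing l p.1 p.2 | p <- enum {: 'I_n.+1 * 'I_n.+1} & critical l (crossing l p.1 p.2)].

Let critsP r : 0 < r -> critical l r -> r \in critical_seq.
Proof.
move=> r0 cr; have [j [k rE]] := critical_crossing l0 r0 cr.
rewrite mem_undup; apply/mapP; exists (j, k) => //.
by rewrite mem_filter /= -rE cr mem_enum.
Qed.

Let critsE r : r \in critical_seq -> 0 < r /\ critical l r.
Proof.
rewrite mem_undup => /mapP[p]; rewrite mem_filter => /andP[cp _] ->.
by split=> //; apply: expR_gt0.
Qed.

Let ratio (z : R[i]) (t : R) : R := Num.max (modulus z / t) (t / modulus z).

Let ratio_ge1 z t : z != 0 -> 0 < t -> 1 <= ratio z t.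
Proof.
rewrite -modulus_gt0 => z0 t0; rewrite le_max.
have [h1|h1] := leP t (modulus z); first by rewrite ler_pdivlMr // mul1r h1.
by rewrite orbC ler_pdivlMr // mul1r (ltW h1).
Qed.

Let key := ('I_(size critical_seq) * bool * 'I_M)%type.

(** Nearest critical radius, side, and level on a geometric scale of the quantity n (ratio - 1 +
    1/n), that is, n times the allowed cell size. The argument of z is left free: a cell is a union
    of annuli, and only its trace on a curve is small. *)
Let in_cell (z : R[i]) (c : key) : bool :=
  let t := nth 0 critical_seq c.1.1 in
  [&& [forall j : 'I_(size critical_seq), ratio z t <= ratio z (nth 0 critical_seq j)],
      ratio z t <= 4,
      (if c.1.2 then t <= modulus z else modulus z <= t) &
      q ^+ c.2 <= 1 + n%:R * (ratio z t - 1) < q ^+ c.2.+1].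

Let h'0 : 0 < h'%:R :> R.
Proof. by apply: lt_le_trans h'_big; have := L0; lra. Qed.

Let q1 : 1 <= q. Proof. by rewrite lerDl invr_ge0. Qed.

Let zero_in_cell z : root (poly_of_coefs l) z -> z != 0 -> [exists c, in_cell z c].
Proof.
move=> rz z0; have [r [cr zr rz4]] := zero_near_critical l0 rz.
have mz : 0 < modulus z by rewrite modulus_gt0.
have r0 : 0 < r by lra.
have rc := critsP r0 cr.
have i0 : (index r critical_seq < size critical_seq)%N by rewrite index_mem.
pose j := [arg min_(j < Ordinal i0) ratio z (nth 0 critical_seq j)]%O.
have minj (i : 'I_(size critical_seq)) :
    ratio z (nth 0 critical_seq j) <= ratio z (nth 0 critical_seq i).
  by rewrite /j; case: Order.TotalTheory.arg_minP => // k _; apply.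
pose t := nth 0 critical_seq j.
have [t0 ct] : 0 < t /\ critical l t by apply: critsE; rewrite mem_nth.
have d1 : 1 <= ratio z t by apply: ratio_ge1.
have d4 : ratio z t <= 4.
  apply: le_trans (minj (Ordinal i0)) _; rewrite /= nth_index //.
  by rewrite ge_max !ler_pdivrMr // zr.
have hM : 1 + n%:R * (ratio z t - 1) < q ^+ M.
  by apply: le_lt_trans M_big; rewrite lerD2l mulrC ler_wpM2r //; lra.
have dn0 : 0 <= n%:R * (ratio z t - 1) by rewrite mulr_ge0 // subr_ge0.
have M0 : (0 < M)%N.
  by rewrite lt0n; apply/eqP => M0; move: hM; rewrite M0 expr0; lra.
have ex : exists i, 1 + n%:R * (ratio z t - 1) < q ^+ i.+1 by exists M.-1; rewrite prednK.
case: (ex_minnP ex) => i hi mini.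
have iM : (i < M)%N by rewrite -(prednK M0) ltnS; apply: mini; rewrite prednK.
apply/existsP; exists (j, t <= modulus z, Ordinal iM).
apply/and4P; split => //=.
- exact/forallP.
- by rewrite -/t; case: leP => // /ltW.
- rewrite -/t hi andbT; case: i hi mini iM => [|i] hi mini iM.
    by rewrite expr0 lerDl mulr_ge0 // subr_ge0.
  by rewrite leNgt; apply/negP => /mini; rewrite ltnn.
Qed.

(** On one level the two ratios differ by at most eps = (d1 - 1 + 1/n) / h'. This passes to the
    radii, and the factor 2 + 4 L of [polar_close] is absorbed by h' >= 112 (2 + 4 L). *)
Let same_cell_close theta z z1 c : log_lipschitz L theta ->
  polar_curve theta z -> polar_curve theta z1 -> z != 0 -> z1 != 0 ->
  in_cell z c -> in_cell z1 c ->
  modulus (z - z1) <= modulus z1 *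
    (ratio z1 (nth 0 critical_seq c.1.1) - 1 + n%:R^-1) / 112.
Proof.
move=> lip [r rp zE] [r1 r1p z1E]; rewrite -/(polar theta r) -/(polar theta r1) in zE z1E.
rewrite -!modulus_gt0 zE z1E !modulus_polar // => r0 r10.
set t := nth 0 critical_seq c.1.1.
have [t0 _] : 0 < t /\ critical l t by apply: critsE; rewrite mem_nth.
move=> /and4P[_ d4 sd /andP[lo hi]] /and4P[_ d14 sd1 /andP[lo1 hi1]].
move: d4 sd lo hi d14 sd1 lo1 hi1; rewrite -/t /ratio !modulus_polar //.
set d := Num.max (r / t) _; set d1 := Num.max (r1 / t) _ => d4 sd lo hi d14 sd1 lo1 hi1.
have n0 : 0 < n%:R :> R by rewrite ltr0n.
have hi0 : 0 < h'%:R^-1 :> R by rewrite invr_gt0.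
pose eps := h'%:R^-1 * (d1 - 1 + n%:R^-1).
have nE : n%:R * n%:R^-1 = 1 :> R by rewrite mulfV // gt_eqF.
have qE : q ^+ c.2.+1 = q ^+ c.2 + h'%:R^-1 * q ^+ c.2 by rewrite exprS /q; ring.
have gap : h'%:R^-1 * q ^+ c.2 <= n%:R * eps.
  have -> : n%:R * eps = h'%:R^-1 * (n%:R * (d1 - 1) + n%:R * n%:R^-1) by rewrite /eps; ring.
  by rewrite nE ler_pM2l //; lra.
have dd : `|d - d1| <= eps.
  rewrite -(ler_pM2l n0) -{1}(gtr0_norm n0) -normrM ler_norml.
  by rewrite mulrBr; apply/andP; split; lra.
have d1_ge1 : 1 <= d1.
  rewrite /d1 le_max; have [h1|h1] := leP t r1; first by rewrite ler_pdivlMr // mul1r h1.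
  by rewrite orbC ler_pdivlMr // mul1r (ltW h1).
have d_ge1 : 1 <= d.
  rewrite /d le_max; have [h1|h1] := leP t r; first by rewrite ler_pdivlMr // mul1r h1.
  by rewrite orbC ler_pdivlMr // mul1r (ltW h1).
have rr : `|r - r1| <= eps * r1.
  case: ifP sd sd1 => _ tr tr1.
    have dE : d = r / t by rewrite /d max_l // ler_pdivlMr // mulrAC ler_pdivrMr // ler_pM // ltW.
    have d1E : d1 = r1 / t by rewrite /d1 max_l // ler_pdivlMr // mulrAC ler_pdivrMr // ler_pM // ltW.
    have -> : r - r1 = (d - d1) * t by rewrite dE d1E; field; rewrite gt_eqF.
    by rewrite normrM (gtr0_norm t0); apply: ler_pM => //; apply: ltW.
  have dE : d = t / r by rewrite /d max_r // ler_pdivlMr // mulrAC ler_pdivrMr // ler_pM // ltW.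
  have d1E : d1 = t / r1 by rewrite /d1 max_r // ler_pdivlMr // mulrAC ler_pdivrMr // ler_pM // ltW.
  have -> : r - r1 = (d1 - d) * (r1 / d).
    by rewrite dE d1E; field; rewrite !gt_eqF.
  have dp : 0 < r1 / d by rewrite divr_gt0 //; lra.
  rewrite normrM (gtr0_norm dp) distrC; apply: ler_pM => //; first exact: ltW.
  rewrite ler_pdivrMr; last lra.
  by rewrite ler_peMr // ltW.
have v1 : n%:R^-1 <= 1 :> R by rewrite invf_le1 // ler1n.
have eps4 : eps <= h'%:R^-1 * 4 by rewrite ler_pM2l //; lra.
have hh : h'%:R^-1 * h'%:R = 1 :> R by rewrite mulVf // gt_eqF.
have hb : h'%:R^-1 * (112 * (2 + 4 * L)) <= 1 by rewrite mulrC ler_pdivrMr // mul1r.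
have LL : 0 <= h'%:R^-1 * L by rewrite mulr_ge0 // ltW.
have e2 : eps <= 2^-1 by lra.
apply: le_trans (polar_close L0 lip r0 r10 e2 rr) _.
rewrite mulrC -mulrA ler_pM2l // /eps mulrA [_ / 112]mulrC ler_wpM2r //.
  by rewrite addr_ge0 ?invr_ge0 // ?subr_ge0 //.
lra.
Qed.

Let zeros_on_curve theta : log_lipschitz L theta ->
  (nb_zeros (polar_curve theta) (poly_of_coefs l) <= 2 * M * N0 * size critical_seq)%N.
Proof.
move=> lip; have [rs pE] := closed_field_poly_normal (poly_of_coefs l).
set a := lead_coef _ in pE.
have p0 : poly_of_coefs l != 0.
  apply/eqP => /(congr1 (fun p : {poly R[i]} => p`_(@ord0 n))).
  by rewrite coef_poly_of_coefs coef0 => /eqP; apply/negP.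
have a0 : a != 0 by rewrite lead_coef_eq0.
rewrite pE nb_zeros_roots //.
set gs := [seq z <- rs | z \in polar_curve theta].
have gsP z : z \in gs -> [/\ polar_curve theta z, root (poly_of_coefs l) z & z != 0].
  rewrite mem_filter => /andP[zG zrs].
  have rz : root (poly_of_coefs l) z by rewrite pE rootZ // root_prod_XsubC.
  split=> //; first by rewrite inE in zG.
  apply/eqP => z0; move: rz; rewrite z0 /root horner_coef0 -[0%N]/(val (@ord0 n)).
  by rewrite coef_poly_of_coefs; apply/negP.
apply: leq_trans (size_le_sum_cells (rel := in_cell) _) _.
  by apply/allP => z /gsP[_ rz z0]; apply: zero_in_cell.
apply: (@leq_trans (\sum_(c : key) N0)%N); last first.
  rewrite sum_nat_const !card_prod card_bool !card_ord.
  by rewrite -[leqRHS](_ : size critical_seq * 2 * M * N0 = _)%N //; ring.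
apply: leq_sum => c _.
case E : [seq x <- gs | in_cell x c] => [|z1 s]; first by [].
rewrite -E; apply: N0_big.
have : z1 \in [seq x <- gs | in_cell x c] by rewrite E mem_head.
rewrite mem_filter => /andP[cz1 /gsP[Gz1 _ z10]].
set t := nth 0 critical_seq c.1.1.
have [t0 ct] : 0 < t /\ critical l t by apply: critsE; rewrite mem_nth.
have mz1 : 0 < modulus z1 by rewrite modulus_gt0.
have d1 := ratio_ge1 z10 t0.
have /and4P[/forallP nearest d4 side _] := cz1.
pose b z := (z \in polar_curve theta) && in_cell z c.
apply: (@root_count_near R h m n l h_big m_gt0 n_gt0 l0 l_spread t (ratio z1 t) z1 _
  (a *: \prod_(z <- rs | ~~ b z) ('X - z%:P))) => //.
- move: side; rewrite -/t /ratio; case: ifP => _ tz; [left|right].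
    rewrite max_l; first by rewrite mulrC divfK // gt_eqF.
    by rewrite ler_pdivlMr // mulrAC ler_pdivrMr // ler_pM // ltW.
  rewrite max_r; first by rewrite mulrC divfK // gt_eqF.
  by rewrite ler_pdivlMr // mulrAC ler_pdivrMr // ler_pM // ltW.
- move=> t' ct' lo hi.
  have t'0 : 0 < t' by apply: lt_trans lo; rewrite divr_gt0 //; lra.
  have i0 : (index t' critical_seq < size critical_seq)%N by rewrite index_mem critsP.
  have := nearest (Ordinal i0); rewrite /= nth_index ?critsP // leNgt -/t => /negP; apply.
  have d0 : 0 < ratio z1 t by lra.
  move: lo; rewrite ltr_pdivrMr // => lo.
  by rewrite [ltLHS]/ratio gt_max !ltr_pdivrMr // mulrC lo mulrC hi.
- move=> z; rewrite mem_filter => /andP[cz /gsP[Gz _ z0]].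
  exact: same_cell_close lip Gz Gz1 z0 z10 cz cz1.
- rewrite -scalerAr [LHS]pE; congr (_ *: _).
  rewrite (bigID b) /=; congr (_ * _).
  by rewrite -filter_predI [RHS]big_filter; apply: eq_bigl => z; rewrite /b /= andbC.
Qed.

Lemma sup_zeros_le : (sup_zeros L (poly_of_coefs l) <= (2 * M * N0)%:R%:E * nb_vertices l)%E.
Proof.
apply: ge_ereal_sup => _ [theta lip <-].
apply: (@le_trans _ _ ((2 * M * N0)%:R%:E * (size critical_seq)%:R%:E)%E).
  by rewrite -EFinM -natrM lee_fin ler_nat zeros_on_curve.
apply: lee_wpmul2l; first by rewrite lee_fin.
by apply: size_le_nb_vertices => [//||r /critsE //]; apply: undup_uniq.
Qed.

End counting_cells.

(** * Measurability of the good event *)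

Section complex_measurability.
Context {R : realType} {d} {T : measurableType d}.
Implicit Types (f g : T -> R[i]).

Definition complex_measurable f :=
  measurable_fun setT (fun w => complex.Re (f w)) /\
  measurable_fun setT (fun w => complex.Im (f w)).

Lemma complex_measurableM f g : complex_measurable f -> complex_measurable g ->
  complex_measurable (fun w => f w * g w).
Proof.
move=> [rf cf] [rg cg]; split.
  have -> : (fun w => complex.Re (f w * g w)) = (fun w =>
     complex.Re (f w) * complex.Re (g w) - complex.Im (f w) * complex.Im (g w)).
    by apply/funext => w; case: (f w) (g w) => [a b] [a' b'].
  by apply: measurable_funB; apply: measurable_funM.
have -> : (fun w => complex.Im (f w * g w)) = (fun w =>
   complex.Re (f w) * complex.Im (g w) + complex.Im (f w) * complex.Re (g w)).
  by apply/funext => w; case: (f w) (g w) => [a b] [a' b'].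
by apply: measurable_funD; apply: measurable_funM.
Qed.

Lemma complex_measurable_cst (a : R[i]) : complex_measurable (fun=> a).
Proof. by split; apply: measurable_cst. Qed.

Lemma complex_measurable_real (f : T -> R) : measurable_fun setT f ->
  complex_measurable (fun w => (f w)%:C%C).
Proof. by move=> mf; split => //=; apply: measurable_cst. Qed.

Lemma complex_measurableX f k : complex_measurable f -> complex_measurable (fun w => f w ^+ k).
Proof.
move=> mf; elim: k => [|k IH]; first exact: complex_measurable_cst.
by under [X in complex_measurable X]eq_fun do rewrite exprS; apply: complex_measurableM.
Qed.

Lemma complex_measurable_sum (I : Type) (s : seq I) (F : I -> T -> R[i]) :
  (forall i, complex_measurable (F i)) -> complex_measurable (fun w => \sum_(i <- s) F i w).
Proof.
move=> mF; split.
  under eq_fun do rewrite raddf_sum /=.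
  by apply: measurable_sum => i; have [] := mF i.
under eq_fun do rewrite raddf_sum /=.
by apply: measurable_sum => i; have [] := mF i.
Qed.

Lemma measurable_modulus f : complex_measurable f -> measurable_fun setT (fun w => modulus (f w)).
Proof.
move=> [rf cf]; under eq_fun do rewrite /modulus normc_def /=.
apply: (measurableT_comp (continuous_measurable_fun (@sqrt_continuous R))).
by apply: measurable_funD; apply: measurable_funX.
Qed.

End complex_measurability.

Section well_spread_measurability.
Variables (R : realType) (h m n : nat).
Let V := n.+1.-tuple R[i].

Lemma measurable_Re : measurable_fun setT (@complex.Re R).
Proof.
move=> _ B mB; rewrite setTI; apply: sub_sigma_algebra; left.
by exists B => //; rewrite setTI.
Qed.

Lemma measurable_Im : measurable_fun setT (@complex.Im R).
Proof.
move=> _ B mB; rewrite setTI; apply: sub_sigma_algebra; right.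
by exists B => //; rewrite setTI.
Qed.

Lemma complex_measurable_tnth (k : 'I_n.+1) : complex_measurable (fun l : V => tnth l k).
Proof.
by split; [apply: (measurableT_comp measurable_Re) | apply: (measurableT_comp measurable_Im)];
  apply: measurable_tnth.
Qed.

Lemma measurable_crossing (j k : 'I_n.+1) : measurable_fun setT (fun l : V => crossing l j k).
Proof.
apply: (measurableT_comp (@measurable_expR R)); apply: measurable_funM; last exact: measurable_cst.
by apply: measurable_funB; apply: (measurableT_comp (@measurable_ln R));
  apply: measurable_modulus; apply: complex_measurable_tnth.
Qed.

Lemma measurable_poorly_spread (al : R) (z : V -> R[i]) : complex_measurable z ->
  measurable [set l : V | poorly_spread m al (tnth l) (z l)].
Proof.
move=> mz.
have -> : [set l : V | poorly_spread m al (tnth l) (z l)] =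
  \bigcup_(i in [set: 'I_n.+1]) \bigcap_(t in [set: 'I_(2 * m)])
    [set l : V | modulus (value (tnth l) (sample al (z l) t)) <
       threshold n m al * (modulus (tnth l i) * modulus (z l) ^+ i)].
  apply/seteqP; split => l /=.
    by move=> /existsP[k /forallP H]; exists k => // t _; apply: H.
  by move=> [k _ H]; apply/existsP; exists k; apply/forallP => t; apply: H.
apply: fin_bigcup_measurable => [|k _]; first exact: finite_finset.
apply: fin_bigcap_measurable => [|t _]; first exact: finite_finset.
rewrite -[X in measurable X]setTI.
apply: (@measurable_fun_ltr _ _ _ setT _ _ _ _ _ [set true]) => //.
  apply: measurable_modulus; apply: complex_measurable_sum => j.
  apply: complex_measurableM; first exact: complex_measurable_tnth.
  apply: complex_measurableX.
  exact: (complex_measurableM mz (complex_measurable_cst ((1 + al) ^+ t)%:C%C)).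
apply: measurable_funM; first exact: measurable_cst.
apply: measurable_funM; first by apply: measurable_modulus; apply: complex_measurable_tnth.
by apply: measurable_funX; apply: measurable_modulus.
Qed.

Lemma measurable_not_well_spread : measurable [set l : V | ~ well_spread h m l].
Proof.
pose I := ('I_n.+1 * 'I_n.+1 * ('I_(8 * (4 * h * n)).+1 * 'I_(8 * (4 * h * n)).+1))%type.
have -> : [set l : V | ~ well_spread h m l] =
  \bigcup_(p in [set p : I | grid_point R h n p.2.1 p.2.2 != 0])
    [set l : V | poorly_spread m (step R h m n) (tnth l)
       ((crossing l p.1.1 p.1.2)%:C%C * grid_point R h n p.2.1 p.2.2)].
  apply/seteqP; split => l /=.
    move=> /existsNP[j /existsNP[k /existsNP[a /existsNP[b /not_implyP[u0 /negP]]]]].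
    by rewrite negbK => P; exists (j, k, (a, b)).
  by move=> [[[j k] [a b]] /= u0 P W]; have := W j k a b u0; rewrite P.
apply: fin_bigcup_measurable => [|p _]; first exact: finite_finset.
apply: measurable_poorly_spread; apply: complex_measurableM; last exact: complex_measurable_cst.
by apply: complex_measurable_real; apply: measurable_crossing.
Qed.

End well_spread_measurability.

(** * From proportions of sign patterns to probabilities *)

Section flip_average.
Variable (R : realType).

(** Double counting: the sum is the integral of the number of events that contain w. *)
Lemma sum_measure_le d (T : measurableType d) (P : probability T R) (K : finType)
    (E : K -> set T) (c : R) : 0 <= c -> (forall k, measurable (E k)) ->
  {ae P, forall w, #|[set k | `[< E k w >] ]%SET|%:R <= c} ->
  (\sum_k P (E k) <= c%:E)%E.
Proof.
move=> c0 mE Ec.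
have -> : (\sum_k P (E k) = \int[P]_w (\sum_k (\1_(E k) w)%:E))%E.
  rewrite ge0_integral_sum //; last first.
    by move=> k; apply/measurable_EFinP; apply: measurable_indic.
  by apply: eq_bigr => k _; rewrite integral_indic // setIT.
have -> : c%:E = (\int[P]_w (cst c%:E) w)%E.
  by rewrite integral_cst //= probability_setT mule1.
apply: ae_ge0_le_integral => //.
- by move=> w _; apply: sume_ge0 => k _; rewrite lee_fin.
- by apply: emeasurable_sum => k; apply/measurable_EFinP; apply: measurable_indic.
- apply: filterS Ec => w h _ /=; rewrite sumEFin lee_fin; apply: le_trans h.
  rewrite -sum1_card natr_sum [leRHS]big_mkcond /=; apply: ler_sum => k _.
  rewrite indicE [in leRHS]inE.
  have -> : (w \in E k) = `[< E k w >] by apply/idP/asboolP; rewrite inE.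
  by case: ifP.
Qed.

Variables (h m n : nat).
Hypotheses (h_big : 224 <= h%:R :> R) (m_gt0 : (0 < m)%N).
Let V := n.+1.-tuple R[i].
Let index := ('I_n.+1 * 'I_n.+1 * ('I_(8 * (4 * h * n)).+1 * 'I_(8 * (4 * h * n)).+1))%type.

Definition flip_set (x y : V) (S : {set 'I_n.+1}) : V := flip (fun k => k \in S) x y.

Lemma tnth_flip_set x y S k : tnth (flip_set x y S) k = mixed (tnth x) (tnth y) S k.
Proof. by rewrite tnth_mktuple. Qed.

(* The scale [crossing l j k] of a flipped vector takes only four values. *)
Lemma card_not_well_spread (x y : V) (a : R[i]) :
  (forall k, 2^-1 * (modulus (tnth x k - a) + modulus (tnth y k - a))
     <= modulus (tnth x k - tnth y k)) ->
  (#|[set S | `[< ~ well_spread h m (flip_set x y S) >] ]%SET| * 2 ^ m <=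
    #|{: index}| * 4 * (2 * n.+1 * 2 ^ n.+1))%N.
Proof.
move=> Theta; pose J := (index * (bool * bool))%type.
pose scale (p : J) : R := expR
  ((ln (modulus (if p.2.1 then tnth x p.1.1.1 else tnth y p.1.1.1)) -
    ln (modulus (if p.2.2 then tnth x p.1.1.2 else tnth y p.1.1.2))) /
   (p.1.1.2%:R - p.1.1.1%:R)).
pose F (p : J) := ([set S | poorly_spread m (step R h m n) (mixed (tnth x) (tnth y) S)
  ((scale p)%:C%C * grid_point R h n p.1.2.1 p.1.2.2)])%SET.
have FB p : (#|F p| * 2 ^ m <= 2 * n.+1 * 2 ^ n.+1)%N.
  exact: (card_poorly_spread (step_gt0 n h_big m_gt0) (step_le1 n h_big m_gt0) m_gt0
           (step_pow n h_big m_gt0) _ Theta).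
have sub : ([set S | `[< ~ well_spread h m (flip_set x y S) >] ] \subset \bigcup_p F p)%SET.
  apply/fintype.subsetP => S; rewrite inE => /asboolP.
  move=> /existsNP[j /existsNP[k /existsNP[c /existsNP[b /not_implyP[_ /negP]]]]].
  rewrite negbK => P; apply/finset.bigcupP.
  exists ((j, k, (c, b)), (j \in S, k \in S)) => //; rewrite inE /scale /=.
  move: P; rewrite /crossing !tnth_flip_set /mixed.
  suff -> : tnth (flip_set x y S) = (fun k => if k \in S then tnth x k else tnth y k) by [].
  by apply/funext => i0; rewrite tnth_flip_set.
apply: leq_trans (leq_mul (subset_leq_card sub) (leqnn _)) _.
apply: (@leq_trans (\sum_(p : J) #|F p| * 2 ^ m)%N).
  rewrite -big_distrl leq_mul2r; apply/orP; right.
  elim/big_rec2: _ => [|p k A _ hp]; first by rewrite cards0.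
  by apply: leq_trans (leq_card_setU _ _) _; rewrite leq_add2l.
apply: (@leq_trans (\sum_(p : J) 2 * n.+1 * 2 ^ n.+1)%N).
  by apply: leq_sum => p _; apply: FB.
by rewrite sum_nat_const card_prod [#|{: bool * bool}|]card_prod card_bool.
Qed.

(** By flip-invariance the 2^(n+1) flipped vectors all have the law of [lam] (the constant sign +
    returns X), so the probability sought equals its average over the patterns, which is bounded
    pointwise by [card_not_well_spread]. *)
Lemma not_well_spread_prob d (T : measurableType d) (P : probability T R)
    (lam : {RV P >-> V}) : property_Theta P lam ->
  (P (lam @^-1` [set l | ~ well_spread h m l]) <=
     ((#|{: index}| * 8 * n.+1)%:R / 2 ^+ m)%:E)%E.
Proof.
move=> [d' [T' [P' [X [Y [XL _ inv [a Theta]]]]]]].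
set B := [set l : V | _]; have mB : measurable B by exact: measurable_not_well_spread.
pose E (S : {set 'I_n.+1}) := (fun w => flip_set (X w) (Y w) S) @^-1` B.
have mE S : measurable (E S).
  rewrite /E -[X in measurable X]setTI; apply: (_ : measurable_fun setT _) => //.
  apply/measurable_fun_tnthP => k.
  have [kS|kS] := boolP (k \in S).
    rewrite (_ : _ \o _ = (fun v : V => tnth v k) \o X).
      by apply: measurableT_comp; [exact: measurable_tnth | exact: measurable_funPT].
    by apply/funext => w /=; rewrite tnth_flip_set /mixed kS.
  rewrite (_ : _ \o _ = (fun v : V => tnth v k) \o Y).
    by apply: measurableT_comp; [exact: measurable_tnth | exact: measurable_funPT].
  by apply/funext => w /=; rewrite tnth_flip_set /mixed (negbTE kS).
have PE S : P' (E S) = P (lam @^-1` B).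
  rewrite -(XL B mB); have := inv (fun k => k \in S) (fun=> true) B mB.
  have -> // : (fun w => flip (fun=> true) (X w) (Y w)) = X :> (T' -> V).
  by apply/funext => w; apply: eq_from_tnth => k; rewrite tnth_mktuple.
pose c : R := (#|{: index}| * 4 * (2 * n.+1 * 2 ^ n.+1))%:R / 2 ^+ m.
have c0 : 0 <= c by rewrite divr_ge0 // exprn_ge0.
have : (\sum_S P' (E S) <= c%:E)%E.
  apply: sum_measure_le => //.
  have Th : {ae P', forall w, forall k : 'I_n.+1,
      2^-1 * (modulus (tnth (X w) k - a) + modulus (tnth (Y w) k - a))
        <= modulus (tnth (X w) k - tnth (Y w) k)} by exact: filter_forall.
  apply: filterS Th => w h1.
  by rewrite ler_pdivlMr ?exprn_gt0 // -natrX -natrM ler_nat (card_not_well_spread h1).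
under eq_bigr do rewrite PE.
have PB : P (lam @^-1` B) \is a fin_num.
  by apply: fin_num_measure; rewrite -[X in measurable X]setTI; exact: measurable_funPT.
have cS : #|{: {set 'I_n.+1}}| = (2 ^ n.+1)%N.
  by rewrite -cardsT -powersetT card_powerset cardsT card_ord.
rewrite -(fineK PB) sumEFin !lee_fin sumr_const cS => H.
have p2 : 0 < (2 ^ n.+1)%:R :> R by rewrite ltr0n expn_gt0.
rewrite -(ler_pM2r p2) [leLHS]mulr_natr; apply: le_trans H _; rewrite /c mulrAC -natrM.
by rewrite ler_wpM2r ?invr_ge0 ?exprn_ge0 // ler_nat; nia.
Qed.

End flip_average.

(** * Numerical bounds in powers of 2^b, with b the binary logarithm of n rounded up *)

Section constants.
Variables (R : realType) (h n : nat).
Hypotheses (h_gt0 : (0 < h)%N) (n_gt1 : (2 <= n)%N).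
Let b := up_log 2 n.

Let n_le : (n <= 2 ^ b)%N.
Proof. by have /andP[] := up_log_bounds (isT : 1 < 2)%N n_gt1. Qed.

Lemma up_log2_gt0 : (0 < b)%N. Proof. by rewrite up_log_gt0. Qed.

Lemma up_log2_le_ln : b%:R <= 2 / ln 2 * ln n%:R :> R.
Proof.
have l2 : 0 < ln 2 :> R by rewrite ln_gt0 // ltr1n.
have n0 : 0 < n%:R :> R by rewrite ltr0n ltnW.
have /andP[lo _] := up_log_bounds (isT : 1 < 2)%N n_gt1.
have h1 : (b.-1)%:R * ln 2 <= ln n%:R :> R.
  rewrite mulr_natl -lnXn // ler_ln ?posrE ?exprn_gt0 // -natrX ler_nat.
  exact: ltnW.
have h2 : ln 2 <= ln n%:R :> R by rewrite ler_ln ?posrE // ler_nat.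
rewrite mulrAC ler_pdivlMr //.
have -> : b%:R = (b.-1)%:R + 1 :> R by rewrite natr1 prednK // up_log2_gt0.
by lra.
Qed.

Let n2_le : (n.+2 <= 2 ^ (2 * b))%N.
Proof.
have b0 := up_log2_gt0.
apply: (@leq_trans (2 * 2 ^ b)); first by have := n_le; move: n_gt1; lia.
by rewrite -expnS leq_exp2l //; lia.
Qed.

(** In units of b the exponents are 2 for each of the three factors n + 1, 33 h + 1 for each of the
    two grid indices, and 3 for the factor 8. *)
Lemma bad_count_le :
  (#|{: 'I_n.+1 * 'I_n.+1 * ('I_(8 * (4 * h * n)).+1 * 'I_(8 * (4 * h * n)).+1)}| * 8 * n.+1
    <= 2 ^ ((66 * h + 11) * b))%N.
Proof.
rewrite !card_prod !card_ord.
have b0 := up_log2_gt0.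
have n1 : (n.+1 <= 2 ^ (2 * b))%N by apply: leq_trans n2_le.
have G1 : ((8 * (4 * h * n)).+1 <= 2 ^ ((33 * h + 1) * b))%N.
  apply: (@leq_trans (33 * h * n)); first by move: h_gt0 n_gt1; nia.
  rewrite mulnDl mul1n expnD; apply: leq_mul => //.
  apply: (@leq_trans (2 ^ (33 * h))); first by apply: ltnW; apply: ltn_expl.
  by rewrite leq_exp2l // leq_pmulr.
have e8 : (8 <= 2 ^ (3 * b))%N by apply: (@leq_trans (2 ^ 3)) => //; rewrite leq_exp2l //; lia.
have -> : (2 ^ ((66 * h + 11) * b) = 2 ^ (2 * b) * 2 ^ (2 * b) *
  (2 ^ ((33 * h + 1) * b) * 2 ^ ((33 * h + 1) * b)) * 2 ^ (3 * b) * 2 ^ (2 * b))%N.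
  by rewrite -!expnD; congr (_ ^ _)%N; lia.
by do !apply: leq_mul.
Qed.

Lemma probability_bound (A : R) (a c : nat) (k : nat) : A <= a%:R ->
  (k <= 2 ^ (c * b))%N -> k%:R / 2 ^+ ((c + a) * b) <= n%:R `^ (- A).
Proof.
move=> Aa kc; have n1 : 1 <= n%:R :> R by rewrite ler1n ltnW.
have p0 : 0 < n%:R `^ A by rewrite powR_gt0 // (lt_le_trans ltr01).
have h1 : n%:R `^ A <= (2 ^ (a * b))%:R.
  apply: le_trans (ler_powR n1 Aa) _.
  rewrite powR_mulrn // -natrX ler_nat mulnC expnM.
  by case: (a) => [|a']; rewrite ?expn0 ?leq_exp2r.
rewrite powRN ler_pdivrMr ?exprn_gt0 // ler_pdivlMl //.
rewrite mulnDl addnC exprD -!natrX; by apply: ler_pM => //; rewrite ?powR_ge0 ?ler_nat.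
Qed.

(** With Z = 4 / al the threshold is 1 / (96 (n + 2)^2 Z^(3m)); both m and log Z are O(b), whence
    the square. The summand 15 is 2 + 2 + 7 + 4, for 4, n + 1, 96 and (n + 2)^2. *)
Lemma threshold_bound (c N : nat) : (0 < c)%N ->
  2 ^+ N * threshold n (c * b) (step R h (c * b) n) <= 4 * n.+1%:R ->
  (N <= (15 + 3 * c * (16 * c * h + 3)) * (b * b))%N.
Proof.
move=> c0; set m := (c * b)%N; have b0 := up_log2_gt0.
have m0 : (0 < m)%N by rewrite muln_gt0 c0.
pose Z : nat := (16 * m * h * n.+1)%N.
have Z0 : 0 < Z%:R :> R by rewrite ltr0n !muln_gt0 c0 b0 h_gt0.
have sZ : step R h m n / 4 = Z%:R^-1.
  rewrite /step -invfM -natrM; congr (_%:R^-1); rewrite /Z; lia.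
rewrite /threshold /smallness sZ => H.
have N20 : 0 < n.+2%:R :> R by [].
have H2 : 2 ^+ N <= 4 * n.+1%:R * (96 * n.+2%:R ^+ 2) * Z%:R ^+ (3 * m) :> R.
  have p : 0 < 96 * n.+2%:R ^+ 2 * Z%:R ^+ (3 * m) :> R.
    by rewrite !mulr_gt0 // exprn_gt0.
  have e : Z%:R^-1 ^+ m * (Z%:R^-1 ^+ (2 * m) / (24 * n.+2%:R ^+ 2)) / 4 =
      (96 * n.+2%:R ^+ 2 * Z%:R ^+ (3 * m))^-1 :> R.
    rewrite !exprVn (_ : 3 * m = m + 2 * m)%N ?exprD; last lia.
    have zm : Z%:R ^+ m != 0 :> R by rewrite gt_eqF // exprn_gt0.
    have z2m : Z%:R ^+ (2 * m) != 0 :> R by rewrite gt_eqF // exprn_gt0.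
    move: (Z%:R ^+ m) (Z%:R ^+ (2 * m)) zm z2m => u v u0 v0.
    have n0 : n.+2%:R != 0 :> R by [].
    by move: (n.+2%:R : R) n0 => w w0; field; rewrite ?u0 ?v0 ?w0.
  by rewrite -mulrA -ler_pdivrMr // -e.
have H3 : (2 ^ N <= 4 * n.+1 * (96 * n.+2 ^ 2) * Z ^ (3 * m))%N.
  by rewrite -(ler_nat R) !natrM !natrX.
rewrite -(@leq_exp2l 2) //; apply: leq_trans H3 _.
have ZB : (Z <= 2 ^ ((16 * c * h + 3) * b))%N.
  have -> : (2 ^ ((16 * c * h + 3) * b) = 2 ^ (16 * c * h * b) * 2 ^ b * 2 ^ (2 * b))%N.
    by rewrite -!expnD; congr (_ ^ _)%N; lia.
  have -> : Z = (16 * c * h * b * n.+1)%N by rewrite /Z /m; lia.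
  apply: leq_mul; last by apply: leq_trans n2_le.
  apply: leq_mul; last by apply: ltnW; apply: ltn_expl.
  apply: (@leq_trans (2 ^ (16 * c * h))); first by apply: ltnW; apply: ltn_expl.
  by rewrite leq_exp2l // leq_pmulr.
have ZmB : (Z ^ (3 * m) <= 2 ^ (3 * c * (16 * c * h + 3) * (b * b)))%N.
  apply: (@leq_trans ((2 ^ ((16 * c * h + 3) * b)) ^ (3 * m))).
    by rewrite leq_exp2r // muln_gt0.
  by rewrite -expnM leq_exp2l // /m; lia.
have e4 : (4 <= 2 ^ (2 * b))%N by apply: (@leq_trans (2 ^ 2)) => //; rewrite leq_exp2l //; lia.
have e96 : (96 <= 2 ^ (7 * b))%N.
  by apply: (@leq_trans (2 ^ 7)) => //; rewrite leq_exp2l //; lia.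
have n22 : (n.+2 ^ 2 <= 2 ^ (4 * b))%N.
  apply: (@leq_trans ((2 ^ (2 * b)) ^ 2)); first by rewrite leq_exp2r.
  by rewrite -expnM leq_exp2l //; lia.
apply: (@leq_trans (2 ^ (2 * b) * 2 ^ (2 * b) * (2 ^ (7 * b) * 2 ^ (4 * b)) *
   2 ^ (3 * c * (16 * c * h + 3) * (b * b)))).
  by do !apply: leq_mul => //; apply: leq_trans n2_le.
by rewrite -!expnD leq_exp2l //; move: (3 * c * _)%N => u; nia.
Qed.

(** Bernoulli gives (1 + 1/h)^h >= 2, and 2^(b + 2) >= 4 n > 1 + 3 n. *)
Lemma cell_number_bound : 1 + 3 * n%:R < (1 + h%:R^-1) ^+ (h * (b + 2)) :> R.
Proof.
have h0 : 0 < h%:R :> R by rewrite ltr0n.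
have two : 2 <= (1 + h%:R^-1) ^+ h :> R.
  have bern k : 1 + k%:R * h%:R^-1 <= (1 + h%:R^-1) ^+ k :> R.
    elim: k => [|k IH]; first by rewrite mul0r addr0 expr0.
    have x0 : 0 <= h%:R^-1 :> R by rewrite invr_ge0.
    rewrite exprS -natr1; apply: le_trans (ler_wpM2l _ IH); last lra.
    by have := mulr_ge0 x0 (mulr_ge0 (ler0n R k) x0); lra.
  by apply: le_trans (bern h); rewrite mulfV ?gt_eqF.
rewrite exprM; apply: (@lt_le_trans _ _ (2 ^+ (b + 2))); last first.
  by rewrite lerXn2r ?nnegrE // exprn_ge0 // addr_ge0 // invr_ge0.
have e : 1 + 3 * n%:R = (1 + 3 * n)%:R :> R by rewrite natrD natrM.
rewrite e -natrX ltr_nat expnD; have := n_le; move: n_gt1; lia.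
Qed.

End constants.

(* "With probability at least p" reads: some measurable event of probability at
   least p is included in the set where the inequality holds (the supremum over
   uncountably many curves is not claimed to be measurable). *)
Theorem theorem1 (R : realType) (L A : R) (hL : 0 <= L) (hA : 0 < A) :
  exists2 C : R, 0 < C &
    forall (n : nat) (hn : (2 <= n)%N)
      (d : measure_display) (T : measurableType d) (P : probability T R)
      (lam : {RV P >-> n.+1.-tuple R[i]}),
      property_Theta P lam ->
      P [set w | tnth (lam w) ord0 = 0] = 0%E ->
      P [set w | tnth (lam w) ord_max = 0] = 0%E ->
      exists E : set T,
        [/\ measurable E,
            ((1 - n%:R `^ (- A))%:E <= P E)%E &
            forall w, E w ->
              (sup_zeros L (poly_of_coefs (lam w))
               <= C%:E * nb_vertices (lam w) * ((ln n%:R) ^+ 3)%:E)%E].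
Proof.
(* One [h] serves both the grid mesh, which needs 224, and the scale of levels, which needs 112 (2 +
   4 L). *)
pose h := (Num.truncn (112 * (2 + 4 * L))).+1.
have hL' : 112 * (2 + 4 * L) <= h%:R by apply/ltW/truncnS_gt.
have h_big : 224 <= h%:R :> R by apply: le_trans hL'; lra.
have h_gt0 : (0 < h)%N by [].
pose a := (Num.truncn A).+1.
have aA : A <= a%:R by apply/ltW/truncnS_gt.
(* 2^(- c b) has to beat the union bound, at most 2^((66 h + 11) b), and still leave 2^(- a b) <=
   n^(- A). *)
pose c := (66 * h + 11 + a)%N.
have c_gt0 : (0 < c)%N by rewrite /c addnS.
pose c' := (15 + 3 * c * (16 * c * h + 3))%N.
(* Two sides of each critical radius, at most 3 h b levels, at most c' b^2 zeros per cell. *)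
pose c'' := (2 * (3 * h) * c')%N.
have l2 : 0 < ln 2 :> R by rewrite ln_gt0 // ltr1n.
exists (c''%:R * (2 / ln 2) ^+ 3).
  by rewrite mulr_gt0 ?exprn_gt0 ?divr_gt0 // ltr0n /c'' /c' !muln_gt0 h_gt0.
move=> n n_gt1 d T P lam Theta P0 _.
pose b := up_log 2 n; pose m := (c * b)%N.
have n_gt0 : (0 < n)%N by apply: ltnW.
have b0 : (0 < b)%N by apply: up_log2_gt0.
have m_gt0 : (0 < m)%N by rewrite muln_gt0 c_gt0 b0.
pose bad := lam @^-1` [set l | ~ well_spread h m l].
pose bad0 := [set w | tnth (lam w) ord0 = 0].
have mbad : measurable bad.
  rewrite /bad -[X in measurable X]setTI.
  by apply: measurable_funPT => //; apply: measurable_not_well_spread.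
have mbad0 : measurable bad0.
  have -> : bad0 = (fun w => modulus (tnth (lam w) ord0)) @^-1` [set 0].
    apply/seteqP; split => w /=; first by move=> ->; rewrite modulus0.
    by move/eqP; rewrite modulus_eq0 => /eqP.
  have mf := measurableT_comp (measurable_modulus (complex_measurable_tnth R (@ord0 n)))
    (measurable_funPT lam).
  by rewrite -[X in measurable X]setTI; apply: mf.
exists (~` (bad `|` bad0)); split.
- by apply: measurableC; apply: measurableU.
- rewrite probability_setC; last exact: measurableU.
  have Pbad : (P (bad `|` bad0) <= (n%:R `^ (- A))%:E)%E.
    apply: le_trans (measureU2 _ mbad mbad0) _.
    rewrite [X in (_ + X)%E]P0 adde0.
    apply: le_trans (not_well_spread_prob h_big m_gt0 Theta) _.
    by rewrite lee_fin; apply: probability_bound => //; apply: bad_count_le.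
  by rewrite EFinB; apply: leeB.
move=> w /not_orP[/contrapT spread l0].
have {}l0 : tnth (lam w) ord0 != 0 by apply/eqP.
pose N0 := (c' * (b * b))%N; pose M := (h * (b + 2))%N.
have := @sup_zeros_le R h m n h M N0 (lam w) L h_big m_gt0 n_gt0 l0 spread hL hL'
  (cell_number_bound R h_gt0 n_gt1) (fun N => @threshold_bound R h n h_gt0 n_gt1 c N c_gt0).
move=> /le_trans; apply.
rewrite muleAC -EFinM; apply: lee_wpmul2r; first by rewrite /nb_vertices measure_ge0.
rewrite lee_fin -mulrA -exprMn.
have hb := up_log2_le_ln R n_gt1.
apply: (@le_trans _ _ (c''%:R * b%:R ^+ 3)).
  rewrite -natrX -natrM ler_nat /N0 /M /c''.
  have h1 : (h * (b + 2) <= 3 * h * b)%N by nia.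
  move: (h * (b + 2))%N (3 * h)%N h1 => u v h1.
  apply: (@leq_trans (2 * (v * b) * (c' * (b * b)))); last by rewrite !expnS expn0; lia.
  by rewrite leq_mul2r leq_mul2l h1 !orbT.
by rewrite ler_wpM2l // lerXn2r // nnegrE // (le_trans _ hb).
Qed.
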